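(* Let $1\to K\to G\to Q\to 1$ be an $\mathrm{ab}$-exact sequence of finitely generated groups. Suppose $Q$ is abelian and $\mathcal{V}_1(G)$ is finite. Then $\dim_{\mathbb{Q}}B(K)\otimes\mathbb{Q}<\infty$ and $\theta_n(K)=0$ for all sufficiently large $n$.
   Context: A short exact sequence of groups $1\to K\to G\to Q\to 1$ is $\mathrm{ab}$-exact if the induced sequence of abelianizations $0\to K_{\mathrm{ab}}\to G_{\mathrm{ab}}\to Q_{\mathrm{ab}}\to 0$ is exact. For $G$ finitely generated, $\mathcal{V}_1(G)=\{\rho\in\mathrm{Hom}(G,\mathbb{C}^* ):\dim_{\mathbb{C}}H_1(G,\mathbb{C}_\rho)\ge1\}$, where $\mathbb{C}_\rho$ is $\mathbb{C}$ with $G$-action via $\rho$. $B(K)=K'/K''$ is the Alexander invariant ($K'=[K,K]$, $K''=[K',K']$). The Chen ranks are $\theta_n(K)=\dim_{\mathbb{Q}}\mathrm{gr}_n(K/K'')\otimes\mathbb{Q}$, where $\mathrm{gr}_n(H)=\gamma_n(H)/\gamma_{n+1}(H)$, $\gamma_1(H)=H$, $\gamma_{n+1}(H)=[H,\gamma_n(H)]$. *)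

(* Defs.v *)
From HB Require Import structures.
From mathcomp Require Import all_boot all_order all_algebra.
From mathcomp Require Import generic_quotient.
From mathcomp Require Import boolp classical_sets cardinality reals.
From mathcomp Require Import complex.
From mathcomp.multinomials Require Import freeg.

Set Implicit Arguments.
Unset Strict Implicit.
Unset Printing Implicit Defensive.

Import GRing.Theory.

Local Open Scope quotient_scope.
Local Open Scope classical_set_scope.

Section Subgroups.
Local Open Scope group_scope.
Variable G : groupType.

Record subgroup := Subgroup {
  subgroup_set :> G -> Prop;
  subgroup1 : subgroup_set 1;
  subgroupF : forall x y, subgroup_set x -> subgroup_set y ->
    subgroup_set (x / y) }.

Record nsubgroup := NSubgroup {
  nsubgroup_subgroup :> subgroup;
  nsubgroupJ : forall x y : G,
    subgroup_set nsubgroup_subgroup x ->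
    subgroup_set nsubgroup_subgroup (x ^ y) }.

Lemma subgroupV (H : subgroup) x : H x -> H x^-1.
Proof.
by move=> Hx; rewrite -[x^-1]mul1g; apply: subgroupF => //; exact: subgroup1.
Qed.

Lemma subgroupM (H : subgroup) x y : H x -> H y -> H (x * y).
Proof.
by move=> Hx Hy; rewrite -[y]invgK; apply: subgroupF => //; exact: subgroupV.
Qed.

Definition full_subgroup : subgroup := @Subgroup (fun=> True) I (fun _ _ _ _ => I).
Definition full_nsubgroup : nsubgroup :=
  @NSubgroup full_subgroup (fun _ _ _ => I).

Section Generated.
Variable A : set G.
Definition gen_set : set G := [set x | forall H : subgroup, A `<=` H -> H x].

Lemma gen1 : gen_set 1.
Proof. by move=> H _; exact: subgroup1. Qed.

Lemma genF x y : gen_set x -> gen_set y -> gen_set (x / y).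
Proof. by move=> Ax Ay H AH; apply: subgroupF; [exact: Ax|exact: Ay]. Qed.

Definition gen : subgroup := Subgroup gen1 genF.

Lemma sub_gen : A `<=` gen.
Proof. by move=> x Ax H; apply. Qed.

Section Conj.
Variables (H : subgroup) (y : G).
Definition conj_set : set G := [set x | H (x ^ y)].
Lemma conj_set1 : conj_set 1.
Proof. by rewrite /conj_set /= conj1g; exact: subgroup1. Qed.
Lemma conj_setF u v : conj_set u -> conj_set v -> conj_set (u / v).
Proof. by rewrite /conj_set /= conjMg conjVg; exact: subgroupF. Qed.
Definition conj_subgroup := Subgroup conj_set1 conj_setF.
End Conj.

Lemma genJ : (forall x y, A x -> A (x ^ y)) ->
  forall x y : G, gen x -> gen (x ^ y).
Proof.
move=> AJ x y gx H AH; apply: (gx (conj_subgroup H y)) => z Az.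
by apply: AH; exact: AJ.
Qed.
End Generated.

Definition commutators (A B : set G) : set G :=
  [set [~ a, b] | a in A & b in B].

Lemma commutatorsJ (A B : nsubgroup) x y :
  commutators A B x -> commutators A B (x ^ y).
Proof.
move=> [a Aa [b Bb <-]]; exists (a ^ y); first exact: nsubgroupJ.
by exists (b ^ y); [exact: nsubgroupJ|rewrite conjRg].
Qed.

Definition comm_nsubgroup (A B : nsubgroup) : nsubgroup :=
  NSubgroup (genJ (@commutatorsJ A B)).

Lemma comm_nsubgroup_subr (A B : nsubgroup) x : comm_nsubgroup A B x -> B x.
Proof.
apply=> _ [a _ [b Bb <-]]; rewrite /commg /conjg !mulgA.
rewrite -[b in X in B X]invgK; apply: subgroupM; last by rewrite invgK.
have -> : a^-1 * b^-1^-1^-1 * a = (b^-1) ^ a by rewrite /conjg invgK !mulgA.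
by apply: nsubgroupJ; exact: subgroupV.
Qed.

Definition derived : nsubgroup := comm_nsubgroup full_nsubgroup full_nsubgroup.

Definition derived2 : nsubgroup := comm_nsubgroup derived derived.

(* Numbered from 1; [lower_central 0] is a junk value equal to
   [lower_central 1]. *)
Definition lower_central (n : nat) : nsubgroup :=
  iter n.-1 (comm_nsubgroup full_nsubgroup) full_nsubgroup.

Definition finitely_generated : Prop :=
  exists s : seq G, gen [set` s] = setT :> set G.

Definition abelian_group : Prop := forall x y : G, commute x y.

End Subgroups.

Section SubgroupType.
Local Open Scope group_scope.
Variables (G : groupType) (H : subgroup G).

Definition subg : Type := {x : G | `[< H x >]}.
HB.instance Definition _ := [isSub of subg for sval].
HB.instance Definition _ := [Choice of subg by <:].

Lemma subg_closed : group_closed [pred x : G | `[< H x >]].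
Proof.
split; first by apply/asboolP; exact: subgroup1.
by move=> x y /asboolP Hx /asboolP Hy; apply/asboolP; exact: subgroupF.
Qed.
HB.instance Definition _ := SubChoice_isSubGroup.Build G _ subg subg_closed.

Section Restrict.
Variable N : nsubgroup G.
Definition restrict_set : set subg := [set x | N (val x)].
Lemma restrict1 : restrict_set 1.
Proof. exact: subgroup1. Qed.
Lemma restrictF x y : restrict_set x -> restrict_set y -> restrict_set (x / y).
Proof. exact: subgroupF. Qed.
Lemma restrictJ x y : Subgroup restrict1 restrictF x ->
  Subgroup restrict1 restrictF (x ^ y).
Proof. exact: nsubgroupJ. Qed.

(* [N `&` H], as a normal subgroup of [subg H] *)
Definition restrict_nsubgroup : nsubgroup subg := NSubgroup restrictJ.
End Restrict.
End SubgroupType.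

Section QuotientGroup.
Local Open Scope group_scope.
Variables (G : groupType) (N : nsubgroup G).

Definition coset_rel (x y : G) : bool := `[< N (x / y) >].

Lemma coset_rel_equiv : equiv_class_of coset_rel.
Proof.
split=> [x|x y|y x z].
- by apply/asboolP; rewrite divgg; exact: subgroup1.
- by apply/asboolP/asboolP => /subgroupV; rewrite invgF.
- move=> /asboolP xy /asboolP yz; apply/asboolP.
  by rewrite -(mulgVK y x) -mulgA; exact: subgroupM.
Qed.
Canonical coset_equiv := EquivRelPack coset_rel_equiv.

Definition quotg : Type := {eq_quot coset_rel}.
HB.instance Definition _ := Choice.on quotg.
HB.instance Definition _ := Quotient.on quotg.
HB.instance Definition _ : EqQuotient _ coset_rel quotg := EqQuotient.on quotg.

Lemma quotg_eq (x y : G) : (\pi_quotg x = \pi_quotg y) <-> N (x / y).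
Proof.
split; first by move/eqquotP/asboolP.
by move=> h; apply/eqquotP/asboolP.
Qed.

Lemma quotg_repr x : N (repr (\pi_quotg x) / x).
Proof. by apply/quotg_eq; rewrite reprK. Qed.

Definition quotg_one : quotg := \pi_quotg (1 : G).
Definition quotg_inv (a : quotg) : quotg := \pi_quotg ((repr a)^-1 : G).
Definition quotg_mul (a b : quotg) : quotg := \pi_quotg (repr a * repr b : G).

Lemma quotg_mulE x y :
  quotg_mul (\pi_quotg x) (\pi_quotg y) = \pi_quotg (x * y : G).
Proof.
have hx := quotg_repr x; have hy := quotg_repr y.
apply/quotg_eq; set a := repr _ in hx *; set b := repr _ in hy *.
have -> : (a * b) / (x * y) = (b / y) ^ a^-1 * (a / x).
  by rewrite /conjg invgK invgM !mulgA mulgVK.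
by apply: subgroupM; [exact: nsubgroupJ|].
Qed.

Lemma quotg_invE x : quotg_inv (\pi_quotg x) = \pi_quotg (x^-1 : G).
Proof.
have hx := quotg_repr x.
apply/quotg_eq; set a := repr _ in hx *; rewrite invgK.
have -> : a^-1 * x = ((a / x)^-1) ^ a by rewrite /conjg invgF !mulgA mulgVK.
by apply: nsubgroupJ; exact: subgroupV.
Qed.

Lemma quotg_mulA : associative quotg_mul.
Proof.
elim/quotW=> x; elim/quotW=> y; elim/quotW=> z.
by rewrite (quotg_mulE y z) (quotg_mulE x y) !quotg_mulE mulgA.
Qed.
Lemma quotg_mul1g : left_id quotg_one quotg_mul.
Proof. by elim/quotW=> x; rewrite quotg_mulE mul1g. Qed.
Lemma quotg_mulg1 : right_id quotg_one quotg_mul.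
Proof. by elim/quotW=> x; rewrite quotg_mulE mulg1. Qed.
Lemma quotg_mulVg : left_inverse quotg_one quotg_inv quotg_mul.
Proof. by elim/quotW=> x; rewrite (quotg_invE x) quotg_mulE mulVg. Qed.
Lemma quotg_mulgV : right_inverse quotg_one quotg_inv quotg_mul.
Proof. by elim/quotW=> x; rewrite (quotg_invE x) quotg_mulE mulgV. Qed.

HB.instance Definition _ := isGroup.Build quotg quotg_mulA quotg_mul1g
  quotg_mulg1 quotg_mulVg quotg_mulgV.

Lemma quotg_piM : {morph (\pi_quotg : G -> quotg) : x y / x * y}.
Proof. by move=> x y; rewrite -quotg_mulE. Qed.

End QuotientGroup.

(* The group of [x] in [H], modulo those lying in [N]; it is [H / N] as soon as
   [N] is contained in [H]. *)
Definition subquotient (G : groupType) (H : subgroup G) (N : nsubgroup G)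
  : groupType := quotg (restrict_nsubgroup H N).

Section Abelianization.
Local Open Scope group_scope.

Definition abelianization (G : groupType) : groupType := quotg (derived G).

Variables (G H : groupType) (f : {multiplicative G -> H}).

Definition ab_fun (a : abelianization G) : abelianization H :=
  \pi_(quotg (derived H)) (f (repr a)).

Lemma mul_morph1 : f 1 = 1.
Proof. by apply: (mulgI (f 1)); rewrite -gmulfM !mulg1. Qed.

Lemma mul_morphV x : f x^-1 = (f x)^-1.
Proof. by apply: (mulgI (f x)); rewrite -gmulfM !mulgV mul_morph1. Qed.

Lemma derived_morph x : derived G x -> derived H (f x).
Proof.
have p1 : derived H (f 1) by rewrite mul_morph1; exact: subgroup1.
have pF y z : derived H (f y) -> derived H (f z) -> derived H (f (y / z)).
  by rewrite gmulfM mul_morphV; exact: subgroupF.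
move=> /(_ (Subgroup (subgroup_set := fun x => derived H (f x)) p1 pF)); apply.
move=> _ [a _ [b _ <-]] /=; apply: sub_gen; exists (f a) => //; exists (f b) => //.
by rewrite /commg /conjg !gmulfM !mul_morphV.
Qed.

Lemma ab_funE (x : G) :
  ab_fun (\pi_(quotg (derived G)) x) = \pi_(quotg (derived H)) (f x).
Proof.
apply/quotg_eq; rewrite -mul_morphV -gmulfM; apply: derived_morph.
by apply/quotg_eq; rewrite reprK.
Qed.

Lemma ab_funM : {morph ab_fun : a b / a * b}.
Proof.
elim/quotW=> x; elim/quotW=> y; rewrite -quotg_piM !ab_funE gmulfM.
exact: quotg_piM.
Qed.

HB.instance Definition _ := isMultiplicative.Build _ _ ab_fun ab_funM.

Definition ab_map : {multiplicative abelianization G -> abelianization H} :=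
  ab_fun.

End Abelianization.

(* [1 -> A -> B -> C -> 1] *)
Definition short_exact (A B C : groupType) (f : {multiplicative A -> B})
    (g : {multiplicative B -> C}) : Prop :=
  [/\ injective f, range f = [set b | g b = 1%g] & range g = setT].

Definition ab_exact (A B C : groupType) (f : {multiplicative A -> B})
    (g : {multiplicative B -> C}) : Prop :=
  short_exact f g /\ short_exact (ab_map f) (ab_map g).

Section Submodules.
Local Open Scope ring_scope.
Variables (F : fieldType) (V : lmodType F).

Record submodule := Submodule {
  submodule_set :> V -> Prop;
  submodule0 : submodule_set 0;
  submoduleP : forall (c : F) u v,
    submodule_set u -> submodule_set v -> submodule_set (c *: u + v) }.

Lemma submoduleD (S : submodule) u v : S u -> S v -> S (u + v).
Proof. by move=> Su Sv; rewrite -[u]scale1r; exact: submoduleP. Qed.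
Lemma submoduleZ (S : submodule) c u : S u -> S (c *: u).
Proof.
by move=> Su; rewrite -[_ *: _]addr0; apply: submoduleP => //; exact: submodule0.
Qed.
Lemma submoduleN (S : submodule) u : S u -> S (- u).
Proof. by move=> Su; rewrite -scaleN1r; exact: submoduleZ. Qed.

Variable A : set V.
Definition span_set : V -> Prop :=
  fun v => forall S : submodule, (forall a, A a -> S a) -> S v.
Lemma span0 : span_set 0.
Proof. by move=> S _; exact: submodule0. Qed.
Lemma spanP c u v : span_set u -> span_set v -> span_set (c *: u + v).
Proof. by move=> Su Sv S AS; apply: submoduleP; [exact: Su|exact: Sv]. Qed.
Definition spanned : submodule := Submodule span0 spanP.
End Submodules.

Section SubmoduleType.
Local Open Scope ring_scope.
Variables (F : fieldType) (V : lmodType F) (S : submodule V).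

Definition subm : Type := {v : V | `[< S v >]}.
HB.instance Definition _ := [isSub of subm for sval].
HB.instance Definition _ := [Choice of subm by <:].

Lemma subm_closed : submod_closed [pred v : V | `[< S v >]].
Proof.
split; first by apply/asboolP; exact: submodule0.
by move=> c u v /asboolP Su /asboolP Sv; apply/asboolP; exact: submoduleP.
Qed.
HB.instance Definition _ :=
  GRing.SubChoice_isSubLmodule.Build F V _ subm subm_closed.

Section Restrict.
Variable T : submodule V.
Lemma restrictm0 : T (val (0 : subm)).
Proof. exact: submodule0. Qed.
Lemma restrictmP c (u v : subm) :
  T (val u) -> T (val v) -> T (val (c *: u + v)).
Proof. exact: submoduleP. Qed.
Definition restrict_submodule : submodule subm :=
  Submodule (submodule_set := fun v => T (val v)) restrictm0 restrictmP.
End Restrict.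
End SubmoduleType.

Section QuotientModule.
Local Open Scope ring_scope.
Variables (F : fieldType) (V : lmodType F) (S : submodule V).

Definition mod_rel (u v : V) : bool := `[< S (u - v) >].

Lemma mod_rel_equiv : equiv_class_of mod_rel.
Proof.
split=> [x|x y|y x z].
- by apply/asboolP; rewrite subrr; exact: submodule0.
- by apply/asboolP/asboolP => /submoduleN; rewrite opprB.
- move=> /asboolP xy /asboolP yz; apply/asboolP.
  by rewrite -(subrK y x) -addrA; exact: submoduleD.
Qed.
Canonical mod_equiv := EquivRelPack mod_rel_equiv.

Definition quotm : Type := {eq_quot mod_rel}.
HB.instance Definition _ := Choice.on quotm.
HB.instance Definition _ := Quotient.on quotm.
HB.instance Definition _ : EqQuotient _ mod_rel quotm := EqQuotient.on quotm.

Lemma quotm_eq (u v : V) : (\pi_quotm u = \pi_quotm v) <-> S (u - v).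
Proof.
split; first by move/eqquotP/asboolP.
by move=> h; apply/eqquotP/asboolP.
Qed.

Definition quotm_zero : quotm := \pi_quotm (0 : V).
Definition quotm_opp (a : quotm) : quotm := \pi_quotm (- repr a : V).
Definition quotm_add (a b : quotm) : quotm := \pi_quotm (repr a + repr b : V).
Definition quotm_scale (c : F) (a : quotm) : quotm := \pi_quotm (c *: repr a : V).

Lemma quotm_repr u : S (repr (\pi_quotm u) - u).
Proof. by apply/quotm_eq; rewrite reprK. Qed.

Lemma quotm_addE u v : quotm_add (\pi_quotm u) (\pi_quotm v) = \pi_quotm (u + v : V).
Proof.
apply/quotm_eq; rewrite opprD addrACA.
by apply: submoduleD; exact: quotm_repr.
Qed.
Lemma quotm_oppE u : quotm_opp (\pi_quotm u) = \pi_quotm (- u : V).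
Proof.
by apply/quotm_eq; rewrite -opprD; apply: submoduleN; exact: quotm_repr.
Qed.
Lemma quotm_scaleE c u : quotm_scale c (\pi_quotm u) = \pi_quotm (c *: u : V).
Proof.
by apply/quotm_eq; rewrite -scalerBr; apply: submoduleZ; exact: quotm_repr.
Qed.

Lemma quotm_addA : associative quotm_add.
Proof.
elim/quotW=> x; elim/quotW=> y; elim/quotW=> z.
by rewrite (quotm_addE y z) (quotm_addE x y) !quotm_addE addrA.
Qed.
Lemma quotm_addC : commutative quotm_add.
Proof. by elim/quotW=> x; elim/quotW=> y; rewrite !quotm_addE addrC. Qed.
Lemma quotm_add0 : left_id quotm_zero quotm_add.
Proof. by elim/quotW=> x; rewrite quotm_addE add0r. Qed.
Lemma quotm_addN : left_inverse quotm_zero quotm_opp quotm_add.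
Proof. by elim/quotW=> x; rewrite (quotm_oppE x) quotm_addE addNr. Qed.

HB.instance Definition _ := GRing.isZmodule.Build quotm quotm_addA quotm_addC
  quotm_add0 quotm_addN.

Lemma quotm_scaleA c d a :
  quotm_scale c (quotm_scale d a) = quotm_scale (c * d) a.
Proof. by elim/quotW: a => x; rewrite (quotm_scaleE d x) !quotm_scaleE scalerA. Qed.
Lemma quotm_scale1 : left_id 1 quotm_scale.
Proof. by elim/quotW=> x; rewrite quotm_scaleE scale1r. Qed.
Lemma quotm_scaleDr : right_distributive quotm_scale +%R.
Proof.
move=> c; elim/quotW=> x; elim/quotW=> y.
by rewrite [\pi_quotm x + \pi_quotm y](quotm_addE x y) (quotm_scaleE c x) (quotm_scaleE c y) quotm_scaleE [RHS]quotm_addE scalerDr.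
Qed.
Lemma quotm_scaleDl a : {morph quotm_scale^~ a : c d / c + d}.
Proof.
by move=> c d; elim/quotW: a => x; rewrite (quotm_scaleE c x) (quotm_scaleE d x) quotm_scaleE [RHS]quotm_addE scalerDl.
Qed.

HB.instance Definition _ := GRing.Zmodule_isLmodule.Build F quotm quotm_scaleA
  quotm_scale1 quotm_scaleDr quotm_scaleDl.

Lemma quotm_pi_linear c u v :
  \pi_quotm (c *: u + v) = c *: \pi_quotm u + \pi_quotm v :> quotm.
Proof. by rewrite -quotm_addE -quotm_scaleE. Qed.

End QuotientModule.

Section Dimension.
Local Open Scope ring_scope.
Variables (F : fieldType) (V : lmodType F).

Definition lin_indep n (e : 'I_n -> V) : Prop :=
  forall c : 'I_n -> F, \sum_(i < n) c i *: e i = 0 -> forall i, c i = 0.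

Definition generates n (e : 'I_n -> V) : Prop :=
  forall v, exists c : 'I_n -> F, v = \sum_(i < n) c i *: e i.

(* [dim_F V = n], [dim_F V >= n] and [dim_F V < oo] *)
Definition has_dim n : Prop :=
  exists e : 'I_n -> V, lin_indep e /\ generates e.
Definition dim_ge n : Prop := exists e : 'I_n -> V, lin_indep e.
Definition fin_dim : Prop := exists n, has_dim n.

End Dimension.

(* [A (x) Q] for a multiplicatively written abelian group [A]: the rational
   vector space with generators [x (x) 1], [x] in [A], subject to
   [xy (x) 1 = x (x) 1 + y (x) 1]. *)
Section TensorQ.
Variable A : groupType.

Definition tensor_relations : set {freeg A / rat} :=
  [set << (x * y)%g >> - << x >> - << y >> | x in setT & y in setT]%R.

Definition tensorQ : lmodType rat := quotm (spanned tensor_relations).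

End TensorQ.

Section NonzeroGroup.
Local Open Scope ring_scope.
Variable F : fieldType.

Definition nonzero : Type := {z : F | z != 0}.
HB.instance Definition _ := [isSub of nonzero for sval].
HB.instance Definition _ := [Choice of nonzero by <:].

Definition nonzero_one : nonzero := Sub 1 (oner_neq0 F).
Lemma nonzero_mulP (x y : nonzero) : val x * val y != 0.
Proof. by rewrite mulf_neq0 ?(valP x) ?(valP y). Qed.
Definition nonzero_mul (x y : nonzero) : nonzero :=
  Sub (val x * val y) (nonzero_mulP x y).
Lemma nonzero_invP (x : nonzero) : (val x)^-1 != 0.
Proof. by rewrite invr_eq0 (valP x). Qed.
Definition nonzero_inv (x : nonzero) : nonzero :=
  Sub (val x)^-1 (nonzero_invP x).

Lemma nonzero_mulA : associative nonzero_mul.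
Proof. by move=> x y z; apply: val_inj; rewrite /= mulrA. Qed.
Lemma nonzero_mul1 : left_id nonzero_one nonzero_mul.
Proof. by move=> x; apply: val_inj; rewrite /= mul1r. Qed.
Lemma nonzero_1mul : right_id nonzero_one nonzero_mul.
Proof. by move=> x; apply: val_inj; rewrite /= mulr1. Qed.
Lemma nonzero_mulV : left_inverse nonzero_one nonzero_inv nonzero_mul.
Proof. by move=> x; apply: val_inj; rewrite /= mulVf // (valP x). Qed.
Lemma nonzero_mulrV : right_inverse nonzero_one nonzero_inv nonzero_mul.
Proof. by move=> x; apply: val_inj; rewrite /= mulfV // (valP x). Qed.

HB.instance Definition _ := isGroup.Build nonzero nonzero_mulA nonzero_mul1
  nonzero_1mul nonzero_mulV nonzero_mulrV.

End NonzeroGroup.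

Section FreeModuleLift.
Local Open Scope ring_scope.
Variables (F : fieldType) (K : choiceType) (M : lmodType F) (f : K -> M).

HB.instance Definition _ := GRing.isZmodMorphism.Build {freeg K / F} M
  (fglift f) (lift_is_additive f).

Lemma fglift_scalable : scalable (fglift f).
Proof.
move=> c D; rewrite -[in RHS](freeg_sumE D).
rewrite [_ *: D](_ : _ = \sum_(x <- dom D) << c * coeff x D *g x >>) //.
rewrite !raddf_sum; apply: eq_bigr => x _.
by rewrite /= !liftU scalerA.
Qed.

HB.instance Definition _ := GRing.isScalable.Build F {freeg K / F} M *:%R
  (fglift f) fglift_scalable.

End FreeModuleLift.

(* [H_1(G, F_rho)], computed from the bar complex
     [F (x) Z[G x G] -> F (x) Z[G] -> F],
   with coefficients in the left module [F_rho] turned into a right module by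
   inversion:
     [d2 [g|h] = rho(g)^-1 [h] - [gh] + [g]],  [d1 [g] = rho(g)^-1 - 1]. *)
Section FirstHomology.
Local Open Scope ring_scope.
Variables (F : fieldType) (G : groupType).
Variable rho : {multiplicative G -> nonzero F}.

Definition bar1 : {linear {freeg G / F} -> F^o} :=
  fglift (fun g => (val (rho g))^-1 - 1 : F^o).

Definition bar2 : {linear {freeg (G * G)%type / F} -> {freeg G / F}} :=
  fglift (fun gh : G * G => (val (rho gh.1))^-1 *: << gh.2 >>
                            - << (gh.1 * gh.2)%g >> + << gh.1 >>).

Lemma bar1_bar2 x : bar1 (bar2 x) = 0.
Proof.
rewrite -(freeg_sumE x) !linear_sum big1 // => -[g h] _.
rewrite /= !liftU !linearZ /= linearD linearB linearZ /= !liftU !scale1r /=.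
rewrite gmulfM /= invfM /GRing.scale /=.
set a := _^-1; set b := _^-1.
rewrite mulrBr mulr1 opprB [a * b - a + _]addrC !addrA !subrK subrr.
exact: mulr0.
Qed.

Definition cycles_set : {freeg G / F} -> Prop := fun x => bar1 x = 0.
Lemma cycles0 : cycles_set 0.
Proof.
exact: raddf0.
Qed.
Lemma cyclesP c x y : cycles_set x -> cycles_set y -> cycles_set (c *: x + y).
Proof.
by move=> hx hy; rewrite /cycles_set linearP hx hy scaler0 addr0.
Qed.
Definition cycles : submodule {freeg G / F} := Submodule cycles0 cyclesP.

Definition boundaries_set : {freeg G / F} -> Prop :=
  fun x => exists z, bar2 z = x.
Lemma boundaries0 : boundaries_set 0.
Proof.
by exists 0; exact: raddf0.
Qed.
Lemma boundariesP c x y :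
  boundaries_set x -> boundaries_set y -> boundaries_set (c *: x + y).
Proof.
by move=> [z <-] [t <-]; exists (c *: z + t); exact: linearP.
Qed.
Definition boundaries : submodule {freeg G / F} :=
  Submodule boundaries0 boundariesP.

Definition first_homology : lmodType F :=
  quotm (restrict_submodule cycles boundaries).

End FirstHomology.

(* The characteristic variety [V_1(G)], over the field of complex numbers. *)
Definition V1 (R : realType) (G : groupType) :
    set {multiplicative G -> nonzero R[i]} :=
  [set rho | dim_ge (first_homology rho) 1].
Arguments V1 : clear implicits.

Definition alexander_invariant (K : groupType) : groupType :=
  subquotient (derived K) (derived2 K).

(* [gr_n(K)], for [n >= 1] *)
Definition gr (n : nat) (K : groupType) : groupType :=
  subquotient (lower_central K n) (lower_central K n.+1).

(* [theta_n(K) = r], for [n >= 1]; the group is [gr_n(K / K'')] *)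
Definition has_chen_rank (K : groupType) (n r : nat) : Prop :=
  has_dim (tensorQ (gr n (quotg (derived2 K)))) r.

(* Main.v *)
Require Import Defs.
From HB Require Import structures.
From mathcomp Require Import all_boot all_order all_algebra.
From mathcomp Require Import generic_quotient.
From mathcomp Require Import boolp classical_sets functions cardinality reals.
From mathcomp Require Import complex.
From mathcomp.multinomials Require Import freeg.
From mathcomp Require Import finmap.
From mathcomp Require Import ring lra.

Set Implicit Arguments.
Unset Strict Implicit.
Unset Printing Implicit Defensive.

Import GRing.Theory Num.Theory Order.TTheory.
Local Open Scope classical_set_scope.
Local Open Scope ring_scope.

(** The proof moves from K to G, then to a complex module over the group ring
of G_ab, shows that this module has finite dimension, and returns to the
rational numbers with the help of homomorphisms to Q.

From K to G. As Q is abelian, G' lies in the image of K, and injectivity of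
K_ab -> G_ab gives i(K') = G' ([derived_lift]). Let M be the tensor product of
C with the abelianization of G'. Conjugation makes G act on M; elements of G'
act trivially, so the operators T_g commute, and M is generated by the classes
of the commutators of generators of G ([commutator_generating]).

Finite dimension ([tensor_finite]). Fix g in G and let a be a complex number
for which T_g - a is not onto. Its image is a proper stable subspace; enlarge
it to a proper stable subspace S modulo which every generator of G acts as a
scalar ([exists_common_eigenvalues]). A nonzero functional on M/S is then a
homomorphism f : G' -> C with f(x^h) = rho(h) f(x), for a character rho with
rho(g) = a. If rho is not trivial, then f extends to a twisted cocycle on G,
and this cocycle detects a nonzero class in H_1(G, C_rho); hence rho lies in
V_1(G) ([equivariant_homology], [eigenvalue_in_V1]). So if V_1(G) is finite,
then T_g - a is onto for all but finitely many a, and by Nakayama it is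
invertible ([nakayama]). Now C is uncountable and M has countable dimension,
so for a vector v the vectors (T_g - a)^-1 v satisfy a linear relation;
clearing denominators gives a nonzero polynomial q with q(T_g) v = 0
([annihilating_poly]). A finitely generated module on which the generators of
G all satisfy polynomial equations has finite dimension
([finite_stable_span]). The counting argument with the uncountable field also
replaces the Nullstellensatz in the construction of S ([exists_eigenvalue]).

Return to Q. A homomorphism K' -> Q extends to a functional on M. If any d + 1
vectors of M are dependent, then any d + 1 elements of K' satisfy one
nontrivial complex relation under all homomorphisms K' -> Q at once
([bounded_rank]). Independent vectors of B(K) (x) Q have dual functionals, so
at most d pure tensors are independent ([alexander_finite]). For the Chen
ranks, suppose that gr_n(K/K'') is not torsion for infinitely many n. Choose
d + 1 such indices n_k, increasing, with h_k in the n_k-th term of the lower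
central series and no power of h_k in the next term. Because Q is divisible,
there are homomorphisms f_k to Q with f_k(h_k) = 1 that vanish on the next
term ([rational_hom]). The matrix of the f_k(h_j) is triangular, against the
relation between the h_k ([lower_central_torsion]). *)

(** * Uncountability of the complex numbers *)

Lemma countable_enum (T : Type) (x0 : T) (A : set T) :
  countable A -> exists e : nat -> T, forall x, A x -> exists n, e n = x.
Proof.
move=> /pfcard_geP[->|[f]]; first by exists (fun=> x0).
by exists f => x /(@surj _ _ _ _ f) [n _ <-]; exists n.
Qed.

Section Uncountable.
Variable R : realType.

Lemma avoid_point (a b x : R) : a < b ->
  exists ab : R * R, [/\ a <= ab.1, ab.1 < ab.2, ab.2 <= b & ~~ (ab.1 <= x <= ab.2)].
Proof.
move=> ltab; have [xm|mx] := leP x (a + (b - a) / 3).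
  exists (a + (b - a) / 3 * 2, b); split => /=; lra.
exists (a, a + (b - a) / 3); split => /=; lra.
Qed.

(** Nested intervals: the n-th closed interval is shrunk so as to miss [e n],
and the supremum of the left endpoints lies in all of them. *)
Lemma real_not_enumerable (e : nat -> R) : exists y, forall n, e n <> y.
Proof.
pose I := {ab : R * R | ab.1 < ab.2}.
have next (n : nat) (u : I) : {v : I | [/\ (val u).1 <= (val v).1,
    (val v).2 <= (val u).2 & ~~ ((val v).1 <= e n <= (val v).2)]}.
  apply: cid; have [ab [h1 h2 h3 h4]] := avoid_point (e n) (valP u).
  by exists (exist _ ab h2).
have lt01 : (0 : R) < 1 by exact: ltr01.
pose J := fix J n : I := if n is m.+1 then sval (next m (J m)) else exist _ (0, 1) lt01.
pose a n := (val (J n)).1; pose b n := (val (J n)).2.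
have aS n : a n <= a n.+1 by rewrite /a /=; case: (next n (J n)) => v [].
have bS n : b n.+1 <= b n by rewrite /b /=; case: (next n (J n)) => v [].
have aD n k : a n <= a (k + n)%N.
  by elim: k => // k IH; apply: le_trans IH _; exact: aS.
have bD n k : b (k + n)%N <= b n.
  by elim: k => // k IH; apply: le_trans IH; exact: bS.
have ab n : a n < b n by exact: (valP (J n)).
have amb m n : a m <= b n.
  rewrite (le_trans (aD m n)) // addnC (le_trans (ltW (ab _))) //; exact: bD.
have hs : has_sup (range a).
  by split; [exists (a 0), 0%N | exists (b 0) => _ [m _ <-]].
exists (sup (range a)) => n En.
have : ~~ (a n.+1 <= e n <= b n.+1) by rewrite /a /b /=; case: (next n (J n)) => v [].
move/negP; apply; rewrite En; apply/andP; split.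
  by apply: ub_le_sup; [case: hs | exists n.+1].
by apply: ge_sup => [|_ [m _ <-]]; [case: hs|].
Qed.
End Uncountable.

Lemma complex_uncountable (R : realType) : ~ countable [set: R[i]].
Proof.
move=> /(countable_enum 0)[e eP].
have [y ey] := real_not_enumerable (fun n => complex.Re (e n)).
by have [n en] := eP (Complex y 0) I; apply: (ey n); rewrite en.
Qed.

(** * Vector spaces of arbitrary dimension *)
Section LinearAlgebra.
Variables (F : fieldType) (V : lmodType F).

Definition combination (n : nat) (e : 'I_n -> V) (v : V) : Prop :=
  exists c : 'I_n -> F, v = \sum_(i < n) c i *: e i.

Definition dependent (n : nat) (e : 'I_n -> V) : Prop :=
  exists2 c : 'I_n -> F, (exists k, c k != 0) & \sum_(i < n) c i *: e i = 0.

Lemma combination0 n (e : 'I_n -> V) : combination e 0.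
Proof.
by exists (fun=> 0); rewrite big1 // => i _; rewrite scale0r.
Qed.

Lemma combinationP n (e : 'I_n -> V) c u v :
  combination e u -> combination e v -> combination e (c *: u + v).
Proof.
move=> [a ->] [b ->]; exists (fun i => c * a i + b i).
rewrite scaler_sumr -big_split /=; apply: eq_bigr => i _.
by rewrite scalerA -scalerDl.
Qed.

Definition combinations n (e : 'I_n -> V) : submodule V :=
  Submodule (@combination0 n e) (@combinationP n e).

Lemma combination_mem n (e : 'I_n -> V) i : combination e (e i).
Proof.
exists (fun j => (j == i)%:R).
rewrite (bigD1 i) //= eqxx scale1r big1 ?addr0 // => j /negPf ->.
by rewrite scale0r.
Qed.

Lemma submodule_sum (S : submodule V) (I : Type) (r : seq I) (P : pred I)
    (f : I -> V) : (forall i, P i -> S (f i)) -> S (\sum_(i <- r | P i) f i).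
Proof.
by move=> Sf; elim/big_ind: _ => //; [exact: submodule0 | exact: submoduleD].
Qed.

Lemma zero_submodule0 : (0 : V) = 0. Proof. by []. Qed.

Lemma zero_submoduleP c (u v : V) : u = 0 -> v = 0 -> c *: u + v = 0.
Proof. by move=> -> ->; rewrite scaler0 addr0. Qed.

Definition zero_submodule : submodule V :=
  @Submodule F V (fun v => v = 0) zero_submodule0 zero_submoduleP.

Section Preimage.
Variables (W : lmodType F) (phi : {linear V -> W}) (S : submodule W).

Lemma preimage0 : S (phi 0).
Proof. by rewrite linear0; exact: submodule0. Qed.

Lemma preimageP c u v : S (phi u) -> S (phi v) -> S (phi (c *: u + v)).
Proof. by rewrite linearP; exact: submoduleP. Qed.

Definition preimage_submodule : submodule V :=
  @Submodule F V (fun v => S (phi v)) preimage0 preimageP.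
End Preimage.

Lemma more_vectors_dependent n (e : 'I_n -> V) (w : 'I_n.+1 -> V) :
  (forall k, combination e (w k)) -> dependent w.
Proof.
move=> /fin_all_exists[c wE].
pose M : 'M[F]_(n.+1, n) := \matrix_(k, j) c k j.
have [u uM u0] : exists2 u : 'rV_n.+1, (u <= kermx M)%MS & u != 0.
  apply/rowV0Pn; rewrite -mxrank_eq0 mxrank_ker subn_eq0 -ltnNge ltnS.
  exact: rank_leq_col.
have [k uk] : exists k, u 0 k != 0.
  apply/existsP; apply: contraNT u0 => /existsPn u0; apply/eqP/rowP => k.
  by rewrite mxE; apply/eqP; have := u0 k; rewrite negbK.
exists (u 0); first by exists k.
under eq_bigr do rewrite wE scaler_sumr.
rewrite exchange_big big1 // => j _.
under eq_bigr do rewrite scalerA.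
rewrite -scaler_suml (_ : \sum_i _ = (u *m M) 0 j).
  by rewrite (sub_kermxP uM) mxE scale0r.
by rewrite mxE; apply: eq_bigr => i _; rewrite mxE.
Qed.

(** Hahn-Banach without a norm: by Zorn, take a subspace [W] that contains [S]
and is maximal among those avoiding [w]. Maximality makes the line of [w] a
complement of [W], and the functional is the coordinate along it. *)
Lemma exists_functional (S : submodule V) (w : V) : ~ S w ->
  exists2 phi : {linear V -> F^o}, forall v, S v -> phi v = 0 & phi w = 1.
Proof.
move=> Sw.
pose good (W : set V) := [/\ forall v, S v -> W v,
  forall c u v, W u -> W v -> W (c *: u + v) & ~ W w].
(* The empty set is admitted because it is the union of the empty chain. *)
have [|W [gW maxW]] := @Zorn_bigcup V (fun W => W = set0 \/ good W).
  move=> C CP Ctot.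
  have [[W0 [CW0 gW0]]|noW] := pselect (exists W0, C W0 /\ good W0); last first.
    left; apply/seteqP; split => // v [W CW Wv].
    have [W0|gW] := CP _ CW; first by rewrite W0 in Wv.
    by case: noW; exists W.
  right; split.
  - by move=> v Sv; exists W0 => //; case: gW0 => + _ _; exact.
  - move=> c u v [W1 CW1 W1u] [W2 CW2 W2v].
    have cl W' : C W' -> W' u -> W' v -> W' (c *: u + v).
      move=> CW' uW' vW'; have [W'0|[_ + _]] := CP _ CW'; last exact.
      by rewrite W'0 in uW'.
    by case: (Ctot _ _ CW1 CW2) => sub; [exists W2 | exists W1] => //;
       apply: cl => //; exact: sub.
  - move=> [W1 CW1 W1w]; have [W10|[_ _]] := CP _ CW1; last exact.
    by rewrite W10 in W1w.
have gS : good S by split => //; exact: submoduleP.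
have {gW}[SW cW Ww] : good W.
  case: gW => // W0; exfalso; apply: (maxW S); last by right.
  by rewrite W0; split => // /(_ 0) S0; apply: S0; exact: submodule0.
have W0 : W 0 by apply: SW; exact: submodule0.
have WZ c u : W u -> W (c *: u) by move=> Wu; rewrite -[_ *: _]addr0; exact: cW.
have coord v : exists a, W (v - a *: w).
  have [Wv|Wv] := pselect (W v); first by exists 0; rewrite scale0r subr0.
  pose B : set V := [set c *: v + u | c in setT & u in W].
  have nB : ~ good B.
    move=> gB; apply: (maxW B); last by right.
    split=> [u Wu|BW]; first by exists 0 => //; exists u => //; rewrite scale0r add0r.
    by apply: Wv; apply: BW; exists 1 => //; exists 0 => //; rewrite scale1r addr0.
  have [c _ [u Wu cu]] : B w.
    apply: contrapT => nBw; apply: nB; split => //.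
      by move=> u Su; exists 0 => //; exists u; [exact: SW | rewrite scale0r add0r].
    move=> c _ _ [a _ [u Wu <-]] [b _ [t Wt <-]].
    exists (c * a + b) => //; exists (c *: u + t); first exact: cW.
    by rewrite scalerDl -scalerA scalerDr addrACA.
  have c0 : c != 0.
    by apply/eqP => c0; apply: Ww; rewrite -cu c0 scale0r add0r.
  exists c^-1; rewrite -cu scalerDr scalerA mulVf // scale1r opprD addrA subrr.
  by rewrite add0r -scaleNr; exact: WZ.
have uniq v a b : W (v - a *: w) -> W (v - b *: w) -> a = b.
  move=> Wa Wb; apply/eqP; rewrite -subr_eq0; apply/negPn/negP => ab.
  apply: Ww; rewrite -[w]scale1r -(mulVf ab).
  rewrite -scalerA; apply: WZ; rewrite scalerBl.
  have -> : a *: w - b *: w = (-1) *: (v - a *: w) + (v - b *: w).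
    by rewrite scaleN1r opprB addrA subrK.
  exact: cW.
pose f v : F^o := sval (cid (coord v)).
have fP v : W (v - f v *: w) by rewrite /f; case: cid.
have flin : linear f.
  move=> c u v; apply: (@uniq (c *: u + v)); first exact: fP.
  have -> : c *: u + v - (c *: f u + f v : F^o) *: w =
      c *: (u - f u *: w) + (v - f v *: w).
    rewrite scalerDl opprD addrACA scalerBr; congr (_ - _ + _).
    by rewrite scalerA.
  by apply: cW; exact: fP.
exists (HB.pack_for {linear V -> F^o} f (GRing.isLinear.Build _ _ _ _ _ flin)) => /=.
  by move=> v Sv; apply: (@uniq v); rewrite ?scale0r ?subr0; [exact: fP | exact: SW].
by apply: (@uniq w); rewrite ?scale1r ?subrr //; exact: fP.
Qed.

(** The combinations of [e] with zero coefficient at [k] do not reach [e k], so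
some functional separates [e k] from them. *)
Lemma dual_functional n (e : 'I_n -> V) k :
  ~ dependent e ->
  exists phi : {linear V -> F^o}, forall j, phi (e j) = (j == k)%:R.
Proof.
move=> ndep.
pose S0 (v : V) := exists2 b : 'I_n -> F, b k = 0 & v = \sum_j b j *: e j.
have S00 : S0 0.
  by exists (fun=> 0) => //; rewrite big1 // => j _; rewrite scale0r.
have S0P c u v : S0 u -> S0 v -> S0 (c *: u + v).
  move=> [a a0 ->] [b b0 ->]; exists (fun j => c * a j + b j).
    by rewrite a0 b0 mulr0 addr0.
  rewrite scaler_sumr -big_split /=; apply: eq_bigr => j _.
  by rewrite scalerA -scalerDl.
have [|phi phi0 phik] := @exists_functional (Submodule S00 S0P) (e k).
  move=> [b bk ek]; apply: ndep; exists (fun j => b j - (j == k)%:R).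
    by exists k; rewrite bk eqxx sub0r oppr_eq0 oner_neq0.
  under eq_bigr do rewrite scalerBl.
  rewrite sumrB -ek [X in _ - X](bigD1 k) //= eqxx scale1r big1 ?addr0 ?subrr //.
  by move=> j /negPf ->; rewrite scale0r.
exists phi => j; have [->|jk] := eqVneq j k; first by rewrite phik.
apply: phi0; exists (fun l => (l == j)%:R); first by rewrite eq_sym (negPf jk).
rewrite (bigD1 j) //= eqxx scale1r big1 ?addr0 // => l /negPf ->.
by rewrite scale0r.
Qed.

Lemma not_lin_indep n (e : 'I_n -> V) : ~ lin_indep e -> dependent e.
Proof.
move=> nind; apply: contrapT => ndep; apply: nind => c c0 i.
by apply: contrapT => /eqP ci; apply: ndep; exists c => //; exists i.
Qed.

(** An independent family in [A] of maximal length exists by the bound, and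
spans [A], hence [V]. *)
Lemma fin_dim_of_bound (A : set V) d : (forall v, spanned A v) ->
  (forall e : 'I_d.+1 -> V, (forall i, A (e i)) -> dependent e) -> fin_dim V.
Proof.
move=> spanA dep.
pose P n := exists2 e : 'I_n -> V, forall i, A (e i) & lin_indep e.
have [n [[e Ae ind] maxn]] : exists n, P n /\ ~ P n.+1.
  have: ~ P d.+1.
    move=> [e Ae ind]; have [c [k ck] c0] := dep _ Ae.
    by rewrite (ind _ c0) eqxx in ck.
  elim: d.+1 => [[]|n IH Pn1].
    by exists (fun i : 'I_0 => 0) => [[]|c _ []].
  by have [/IH//|Pn] := pselect (~ P n); exists n; split => //; exact: contrapT.
exists n, e; split => // v; apply: (spanA v (combinations e)) => a Aa {v}.
pose e' (i : 'I_n.+1) := if unlift ord0 i is Some j then e j else a.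
have [|c [k ck]] := @not_lin_indep _ e'.
  by move=> ind'; apply: maxn; exists e' => // i; rewrite /e'; case: unliftP.
rewrite big_ord_recl /e' unlift_none.
under eq_bigr do rewrite liftK.
move=> c0; have [c00|c00] := eqVneq (c ord0) 0.
  move: c0 ck; rewrite c00 scale0r add0r => /ind cj.
  by case: (unliftP ord0 k) => [j|] ->; rewrite ?c00 ?cj eqxx.
exists (fun j => - ((c ord0)^-1 * c (fintype.lift ord0 j))).
apply: (scalerI c00); rewrite scaler_sumr; apply/eqP.
rewrite -subr_eq0 -sumrN -[X in _ == X]c0; apply/eqP; congr (_ + _).
by apply: eq_bigr => j _; rewrite scalerA mulrN scaleNr opprK mulVKf.
Qed.

End LinearAlgebra.

Definition kernel (F : fieldType) (V W : lmodType F) (phi : {linear V -> W}) :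
  submodule V := preimage_submodule phi (zero_submodule W).

(** * Modules over commuting operators *)
Section Operators.
Variables (F : fieldType) (V : lmodType F) (I : Type) (T : I -> {linear V -> V}).
Hypothesis TC : forall a b v, T a (T b v) = T b (T a v).

(** Polynomial expressions in the operators [T]. They stand for the elements of
the commutative algebra that the [T a] generate; working with expressions
keeps linearity and commutation available by construction. *)
Inductive opexpr : Type :=
  | Scal of F
  | Gen of I
  | Add of opexpr & opexpr
  | Mul of opexpr & opexpr.

Fixpoint op (e : opexpr) : {linear V -> V} :=
  match e with
  | Scal c => GRing.scale c
  | Gen a => T a
  | Add e1 e2 => op e1 \+ op e2
  | Mul e1 e2 => op e1 \o op e2
  end.

Definition stable (S : submodule V) : Prop := forall a v, S v -> S (T a v).

Lemma op_stable (S : submodule V) : stable S -> forall e v, S v -> S (op e v).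
Proof.
move=> Sst; elim=> [c|a|e1 IH1 e2 IH2|e1 IH1 e2 IH2] v Sv /=.
- exact: submoduleZ.
- exact: Sst.
- by apply: submoduleD; [exact: IH1 | exact: IH2].
- by apply: IH1; exact: IH2.
Qed.

Lemma op_gen e a v : op e (T a v) = T a (op e v).
Proof.
elim: e v => [c|b|e1 IH1 e2 IH2|e1 IH1 e2 IH2] v /=.
- by rewrite linearZ.
- exact: TC.
- by rewrite IH1 IH2 linearD.
- by rewrite IH2 IH1.
Qed.

Lemma op_comm e1 e2 v : op e1 (op e2 v) = op e2 (op e1 v).
Proof.
elim: e1 v => [c|b|e1 IH1 e1' IH1'|e1 IH1 e1' IH1'] v /=.
- by rewrite linearZ.
- by rewrite op_gen.
- by rewrite IH1 IH1' linearD.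
- by rewrite IH1' IH1.
Qed.

(** The vectors in [s] generate [V] modulo [S] as a module over the operators.
Working modulo [S] makes quotient modules unnecessary. *)
Definition generating (S : submodule V) (s : seq V) : Prop :=
  forall S' : submodule V, stable S' -> (forall v, S v -> S' v) ->
  (forall x, x \in s -> S' x) -> forall v, S' v.

Section Cyclic.
Variables (S : submodule V) (Sst : stable S) (x : V).

Definition cyclic_set (v : V) : Prop := exists e, S (v - op e x).

Lemma cyclic0 : cyclic_set 0.
Proof.
by exists (Scal 0); rewrite /= scale0r subr0; exact: submodule0.
Qed.

Lemma cyclicP c u v : cyclic_set u -> cyclic_set v -> cyclic_set (c *: u + v).
Proof.
move=> [a Sa] [b Sb]; exists (Add (Mul (Scal c) a) b) => /=.
by rewrite opprD addrACA -scalerBr; exact: submoduleP.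
Qed.

Definition cyclic : submodule V := Submodule cyclic0 cyclicP.

Lemma cyclic_stable : stable cyclic.
Proof.
move=> a v [e Se]; exists (Mul (Gen a) e).
by rewrite /= -linearB; exact: Sst.
Qed.

Lemma sub_cyclic v : S v -> cyclic v.
Proof. by exists (Scal 0); rewrite /= scale0r subr0. Qed.

Lemma cyclic_gen : cyclic x.
Proof. by exists (Scal 1); rewrite /= scale1r subrr; exact: submodule0. Qed.
End Cyclic.

Section Image.
Variables (S : submodule V) (Sst : stable S) (t : opexpr).

Definition image_set (v : V) : Prop := exists w, S (v - op t w).

Lemma image0 : image_set 0.
Proof. by exists 0; rewrite linear0 subr0; exact: submodule0. Qed.

Lemma imageP c u v : image_set u -> image_set v -> image_set (c *: u + v).
Proof.
move=> [a Sa] [b Sb]; exists (c *: a + b).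
by rewrite linearP opprD addrACA -scalerBr; exact: submoduleP.
Qed.

Definition image_mod : submodule V := Submodule image0 imageP.

Lemma image_stable : stable image_mod.
Proof.
move=> a v [w Sw]; exists (T a w).
by rewrite op_gen -linearB; exact: Sst.
Qed.

Lemma sub_image v : S v -> image_mod v.
Proof. by exists 0; rewrite linear0 subr0. Qed.

Lemma image_op v : image_mod (op t v).
Proof. by exists v; rewrite subrr; exact: submodule0. Qed.
End Image.

(** A surjective endomorphism of a finitely generated module over a commutative
ring is invertible, and its inverse lies in the ring. The usual proof uses a
determinant; here the generators are removed one by one. Modulo the submodule
of [x], induction gives an inverse [r]. Then [u = 1 - t r] maps everything
into the submodule of [x], and with [x = t w] and [u w = c x] one finds that
[u - t c] kills [x], so [(u - t c) u] is zero; it has the form [1 - t r']. *)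
Lemma nakayama (s : seq V) (S : submodule V) (t : opexpr) : stable S ->
  generating S s -> (forall v, image_mod S t v) ->
  exists r, forall v, S (v - op t (op r v)).
Proof.
elim: s S => [|x s IH] S Sst gen onto.
  exists (Scal 0) => v /=; rewrite scale0r linear0 subr0.
  by apply: (gen S) => //.
have [||r rP] := IH (cyclic S x) (cyclic_stable Sst (x := x)).
- move=> S' S'st sub mem; apply: gen => // [v Sv|y].
    by apply: sub; exact: sub_cyclic.
  by rewrite inE => /predU1P[->|/mem//]; apply: sub; exact: cyclic_gen.
- by move=> v; have [w Sw] := onto v; exists w; exact: sub_cyclic.
have [u uE] : exists u, forall v, op u v = v - op t (op r v).
  by exists (Add (Scal 1) (Mul (Scal (-1)) (Mul t r))) => v;
     rewrite /= scale1r scaleN1r.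
have [w Sw] := onto x; have [c Sc] := rP w; rewrite -uE in Sc.
pose f z := op u z - op t (op c z).
have fB y z : f (y - z) = f y - f z.
  by rewrite /f !(linearB (op _)) opprD addrACA -opprD.
have fd d z : f (op d z) = op d (f z).
  by rewrite /f (linearB (op _)) (op_comm d) (op_comm d t) (op_comm d c).
have fS z : S z -> S (f z).
  by move=> Sz; rewrite /f; apply: submoduleD;
     [|apply: submoduleN; apply: op_stable => //]; exact: op_stable.
have Sx : S (f x).
  have -> : f x = op u (x - op t w) + op t (op u w - op c x).
    by rewrite /f !(linearB (op _)) (op_comm u t) addrA subrK.
  by apply: submoduleD; exact: op_stable.
have [r' r'E] : exists r', forall v,
    op r' v = op r v + op r (op u v) + op c (op u v).
  by exists (Add (Add r (Mul r u)) (Mul c u)).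
exists r' => v; have [d Sd] := rP v; rewrite -uE in Sd.
have -> : v - op t (op r' v) = f (op u v - op d x) + op d (f x).
  rewrite fB (fd d x) subrK /f r'E [op u (op u v)]uE [X in X - _ - _]uE.
  by rewrite !(linearD (op _)) !opprD !addrA.
by apply: submoduleD; [exact: fS | exact: op_stable].
Qed.
End Operators.

(** * Polynomials in one operator *)
Section PolynomialsOfOperators.
Variables (F : fieldType) (V : lmodType F) (I : eqType).
Variable T : I -> {linear V -> V}.
Hypothesis TC : forall a b v, T a (T b v) = T b (T a v).
Implicit Types (t r : opexpr F I) (p q : {poly F}) (S : submodule V).

Notation op := (op T).

(** Horner evaluation of [p] at [t]. *)
Definition polyop t p : opexpr F I :=
  foldr (fun c e => Add (Scal I c) (Mul t e)) (Scal I 0) p.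

Definition shift t (a : F) : opexpr F I := Add t (Scal I (- a)).

Lemma op_shift t a v : op (shift t a) v = op t v - a *: v.
Proof. by rewrite /= scaleNr. Qed.

Lemma polyop_sum t p n v : (size p <= n)%N ->
  op (polyop t p) v = \sum_(i < n) p`_i *: iter i (op t) v.
Proof.
rewrite /polyop; elim: (polyseq p) n => [|c l IH] [|n] //= ln.
- by rewrite big_ord0 scale0r.
- by rewrite scale0r big1 // => i _; rewrite nth_nil scale0r.
- rewrite big_ord_recl (IH n) //= linear_sum; congr (_ + _).
  by apply: eq_bigr => i _; rewrite linearZ.
Qed.

Lemma polyopD t p q v :
  op (polyop t (p + q)) v = op (polyop t p) v + op (polyop t q) v.
Proof.
set n := maxn (size p) (size q).
rewrite !(@polyop_sum _ _ n) ?leq_maxl ?leq_maxr ?size_polyD //.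
by rewrite -big_split; apply: eq_bigr => i _ /=; rewrite coefD scalerDl.
Qed.

Lemma polyopZ t c p v : op (polyop t (c *: p)) v = c *: op (polyop t p) v.
Proof.
rewrite !(@polyop_sum _ _ (size p)) ?size_scale_leq // scaler_sumr.
by apply: eq_bigr => i _ /=; rewrite coefZ scalerA.
Qed.

Lemma polyopXM t p v : op (polyop t ('X * p)) v = op t (op (polyop t p) v).
Proof.
rewrite (@polyop_sum _ _ (size p).+1); last first.
  by rewrite (leq_trans (size_polyMleq _ _)) // size_polyX.
rewrite (@polyop_sum _ _ (size p)) // big_ord_recl coefXM eqxx scale0r add0r.
by rewrite linear_sum; apply: eq_bigr => i _; rewrite linearZ coefXM.
Qed.

Lemma polyop1 t v : op (polyop t 1) v = v.
Proof.
by rewrite (@polyop_sum _ _ 1) ?size_poly1 // big_ord1 coef1 eqxx scale1r.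
Qed.

Lemma polyop_factor t a p v :
  op (polyop t (('X - a%:P) * p)) v = op (shift t a) (op (polyop t p) v).
Proof.
rewrite mulrDl polyopD polyopXM -polyCN mul_polyC polyopZ.
by rewrite op_shift scaleNr.
Qed.

Lemma polyopC t a v : op (polyop t a%:P) v = a *: v.
Proof. by rewrite -[a%:P]mulr1 mul_polyC polyopZ polyop1. Qed.

Lemma polyopM t p q v :
  op (polyop t (p * q)) v = op (polyop t p) (op (polyop t q) v).
Proof.
elim/poly_ind: p => [|p c IH].
  by rewrite mul0r (@polyop_sum _ _ 0) ?size_poly0 // big_ord0
             (@polyop_sum _ _ 0) ?size_poly0 // big_ord0.
rewrite mulrDl [p * 'X]mulrC -mulrA mul_polyC !polyopD !polyopXM IH polyopZ.
by rewrite polyopC.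
Qed.

Lemma polyop_sumE t (J : finType) (f : J -> {poly F}) v :
  op (polyop t (\sum_j f j)) v = \sum_j op (polyop t (f j)) v.
Proof.
apply: (big_morph (fun p => op (polyop t p) v)) => [p q|]; first exact: polyopD.
by rewrite (@polyop_sum _ _ 0) ?size_poly0 // big_ord0.
Qed.

Lemma generating_sub S S' s :
  (forall v, S v -> S' v) -> generating T S s -> generating T S' s.
Proof. by move=> sub gen U Ust S'U; apply: gen => // v /sub/S'U. Qed.

(** For each [a] in the uncountable set [D] there is an inverse [r a] of [t - a].
As [V] is spanned by a sequence, some finite piece of that sequence, of length
[N], already spans [op (r a) v] for infinitely many [a]; any [N + 1] of these
vectors satisfy a relation with coefficients [b k] at the points [c k].
Multiplication by the product of the [t - c k] turns it into [q(t) v = 0], with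
[q] the sum of the [b k] times the products of the ['X - c l], [l != k]. It is
nonzero because its value at [c k] is nonzero when [b k] is. *)
Lemma annihilating_poly S s t (D : set F) (e : nat -> V) :
  (forall v, exists N, combination (fun k : 'I_N => e k) v) ->
  ~ countable D -> stable T S -> generating T S s ->
  (forall a, D a -> forall v, image_mod T S (shift t a) v) ->
  forall v, exists2 q, q != 0 & S (op (polyop t q) v).
Proof.
move=> espan Dunc Sst gen onto v.
have [r rP] : exists r : F -> opexpr F I, forall a, D a ->
    forall v, S (v - op (shift t a) (op (r a) v)).
  have /choice[r rP] : forall a, exists r, D a ->
      forall v, S (v - op (shift t a) (op r v)).
    move=> a; have [Da|nDa] := pselect (D a); last by exists t.
    by have [r rP] := nakayama TC Sst gen (onto a Da); exists r.
  by exists r.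
pose DN N := [set a | D a /\ combination (fun k : 'I_N => e k) (op (r a) v)].
have [N infN] : exists N, infinite_set (DN N).
  apply: contrapT => fin; apply: Dunc.
  apply: (@sub_countable _ _ _ (\bigcup_N DN N)).
    apply: subset_card_le => a Da; have [N comb] := espan (op (r a) v).
    by exists N.
  apply: bigcup_countable => // N _; apply: finite_set_countable.
  by apply: contrapT => infN; apply: fin; exists N.
have [B BD Bsize] := infinite_set_fset N.+1 infN.
pose c (k : 'I_N.+1) : F := (enum_fset B)`_k.
have kB (k : 'I_N.+1) : (k < size (enum_fset B))%N by apply: leq_trans Bsize.
have cD k : DN N (c k) by apply: BD; exact: mem_nth.
have c_inj : injective c.
  move=> k l /eqP; rewrite nth_uniq ?fset_uniq // => /eqP; exact: val_inj.
have [b [k0 bk0] b0] := more_vectors_dependent (fun k => (cD k).2).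
pose Q k := \prod_(l < N.+1 | l != k) ('X - (c l)%:P).
pose P := \prod_(l < N.+1) ('X - (c l)%:P).
have PQ k : P = ('X - (c k)%:P) * Q k by rewrite /P (bigD1 k).
exists (\sum_k b k *: Q k).
  apply/eqP => /(congr1 (horner^~ (c k0))); apply/eqP.
  rewrite horner_sum horner0 (bigD1 k0) //= [X in _ + X]big1 ?addr0.
    rewrite hornerZ mulf_neq0 // /Q horner_prod; apply/prodf_neq0 => l lk.
    by rewrite !hornerE subr_eq0; apply: contra lk => /eqP/c_inj->.
  move=> k kk0; rewrite hornerZ /Q horner_prod (bigD1 k0) 1?eq_sym //=.
  by rewrite hornerXsubC subrr mul0r mulr0.
rewrite polyop_sumE.
have -> : \sum_k op (polyop t (b k *: Q k)) v =
    \sum_k b k *: op (polyop t (Q k)) (v - op (shift t (c k)) (op (r (c k)) v)).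
  transitivity (\sum_k op (polyop t (b k *: Q k)) v -
      op (polyop t P) (\sum_k b k *: op (r (c k)) v)).
    by rewrite b0 linear0 subr0.
  rewrite linear_sum -sumrB; apply: eq_bigr => k _.
  rewrite polyopZ linearZ -scalerBr; congr (_ *: _).
  rewrite (linearB (op _)) (PQ k) polyop_factor.
  by rewrite (op_comm TC (shift _ _)).
apply: submodule_sum => k _; apply: submoduleZ; apply: op_stable => //.
by apply: rP; exact: (cD k).1.
Qed.

End PolynomialsOfOperators.

(** * Common eigenvalues on a quotient *)
Section CommonEigenvalue.
Variables (F : closedFieldType) (V : lmodType F) (I : eqType).
Variable T : I -> {linear V -> V}.
Hypothesis TC : forall a b v, T a (T b v) = T b (T a v).
Hypothesis F_uncountable : ~ countable [set: F].
Variable e : nat -> V.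
Hypothesis e_span : forall v, exists N, combination (fun k : 'I_N => e k) v.
Implicit Types (t : opexpr F I) (S : submodule V).

Notation op := (op T).

(** If [t - a] were onto modulo [S] for all [a], then each [t - a] would be
invertible there, while some nonzero product of factors [t - z] kills [x]
modulo [S]. *)
Lemma exists_eigenvalue S s x t : stable T S -> generating T S s -> ~ S x ->
  exists a y, ~ image_mod T S (shift t a) y.
Proof.
move=> Sst gen Sx; apply: contrapT => onto; apply: Sx.
have {}onto a y : image_mod T S (shift t a) y.
  by apply: contrapT => nim; apply: onto; exists a, y.
have [|q q0 Sq] := annihilating_poly TC e_span F_uncountable Sst gen
  (t := t) _ x; first by move=> a _; exact: onto.
have [l qE] := closed_field_poly_normal q.
have : S (op (polyop t (\prod_(z <- l) ('X - z%:P))) x).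
  have : S ((lead_coef q)^-1 *: op (polyop t q) x) by exact: submoduleZ.
  by rewrite [in polyop t q]qE polyopZ scalerA mulVf ?lead_coef_eq0 // scale1r.
elim: l {qE} => [|z l IH]; first by rewrite big_nil polyop1.
rewrite big_cons polyop_factor => Sz; apply: IH.
have [r rP] := nakayama TC Sst gen (onto z).
set w := op (polyop t _) x in Sz *.
rewrite -[w](subrK (op (shift t z) (op r w))); apply: submoduleD; first exact: rP.
by rewrite (op_comm TC); exact: op_stable.
Qed.

(** The image of [T i - a], together with [S], is again a proper stable
submodule, and [T i] acts on the quotient by [a]; treat the operators of [l] in
turn. *)
Lemma exists_common_eigenvalues S s x (l : seq I) :
  stable T S -> generating T S s -> ~ S x ->
  exists S' y, [/\ stable T S', forall v, S v -> S' v, ~ S' y &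
    forall i, i \in l -> exists c, forall v, S' (T i v - c *: v)].
Proof.
elim: l S x => [|i l IH] S x Sst gen Sx; first by exists S, x; split.
have [a [y Sy]] := exists_eigenvalue (Gen F i) Sst gen Sx.
have sub := @sub_image _ _ _ T S (shift (Gen F i) a).
have [S' [z [S'st SS' S'z eig]]] := IH _ _
  (image_stable TC Sst (t := shift (Gen F i) a)) (generating_sub sub gen) Sy.
exists S', z; split => // [v /sub/SS'//|j]; rewrite inE => /predU1P[->|/eig//].
by exists a => v; rewrite -(op_shift T (Gen F i)); apply: SS'; exact: image_op.
Qed.
End CommonEigenvalue.

(** * Finite dimension from polynomial equations *)
Section FiniteSpan.
Variables (F : fieldType) (V : lmodType F) (I : eqType).
Variable T : I -> {linear V -> V}.
Hypothesis TC : forall a b v, T a (T b v) = T b (T a v).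

(** Division with remainder by [q]: all powers of [T i] reduce to the powers
below the degree of [q]. *)
Lemma iter_spanned i q x n (t := Gen F i) : q != 0 ->
  (forall v, op T (polyop t q) v = 0) ->
  spanned [set iter a (T i) x | a in [set a | (a < (size q).-1)%N]]
    (iter n (T i) x).
Proof.
move=> q0 qT; elim/ltn_ind: n => n IH.
have [nm|mn] := ltnP n (size q).-1; first by move=> S SA; apply: SA; exists n.
have qsz : size q = (size q).-1.+1 by rewrite prednK // lt0n size_poly_eq0.
set m := (size q).-1 in mn qsz IH *; set W := spanned _ in IH;
have := qT (iter (n - m) (T i) x).
rewrite (@polyop_sum _ _ _ _ _ _ (size q)) // qsz big_ord_recr /=.
rewrite -iterD subnKC // => /eqP; rewrite addrC addr_eq0 => /eqP eqn.
rewrite -[iter n _ _]scale1r -(mulVf (x := q`_m)) ?lead_coef_eq0 // -scalerA eqn.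
apply: (@submoduleZ _ _ W); apply: submoduleN; apply: submodule_sum => k _.
apply: submoduleZ; rewrite -iterD; apply: IH.
by rewrite addnC -ltn_subRL subKn.
Qed.

(** When one more operator [T i] is treated, the span of [s'] is replaced by the
span of the vectors [T i ^ a x], with [x] in [s'] and [a] below the degree of
the equation of [T i]; it stays stable under the earlier operators because they
commute with [T i]. *)
Lemma finite_stable_span (l : seq I) (s : seq V) :
  (forall i, i \in l -> exists2 q, q != 0 &
     forall v, op T (polyop (Gen F i) q) v = 0) ->
  exists s' : seq V, (forall x, x \in s -> spanned [set` s'] x) /\
    forall i v, i \in l -> spanned [set` s'] v -> spanned [set` s'] (T i v).
Proof.
elim: l => [|i l IH] ann.
  by exists s; split => // x xs S; apply.
have [j jl|s' [ss' s'st]] := IH; first by apply: ann; rewrite inE jl orbT.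
have [q q0 qT] := ann i (mem_head _ _).
pose s'' := [seq iter a (T i) x | a <- iota 0 (size q).-1, x <- s'].
have iter_s'' n x : x \in s' -> spanned [set` s''] (iter n (T i) x).
  move=> xs; apply: (iter_spanned n q0 qT) => _ [a /= am <-].
  by move=> S; apply; apply/allpairsP; exists (a, x); rewrite mem_iota.
have iter_W n v : spanned [set` s'] v -> spanned [set` s''] (iter n (T i) v).
  have W0 : spanned [set` s''] (iter n (T i) 0).
    suff -> : iter n (T i) 0 = 0 by exact: submodule0.
    by elim: n => // n; rewrite iterS => ->; rewrite linear0.
  have WP c u w : spanned [set` s''] (iter n (T i) u) ->
      spanned [set` s''] (iter n (T i) w) ->
      spanned [set` s''] (iter n (T i) (c *: u + w)).
    have -> : iter n (T i) (c *: u + w) = c *: iter n (T i) u + iter n (T i) w.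
      by elim: n {W0} => // n; rewrite !iterS => ->; rewrite linearP.
    exact: submoduleP.
  by move=> /(_ (Submodule W0 WP)); apply => x xs; exact: iter_s''.
exists s''; split=> [x xs|j v jl]; first exact: (iter_W 0%N _ (ss' x xs)).
move=> /(_ (preimage_submodule (T j) (spanned [set` s'']))); apply.
move=> _ /allpairsP[[a x] /= [_ xs ->]].
move: jl; rewrite inE => /predU1P[->|jl]; first exact: (iter_s'' a.+1).
have -> : T j (iter a (T i) x) = iter a (T i) (T j x).
  by elim: a => // a IHa; rewrite !iterS TC IHa.
by apply: iter_W; apply: s'st => // S; apply.
Qed.

Lemma spanned_combination (s : seq V) v :
  spanned [set` s] v -> combination (fun k : 'I_(size s) => s`_k) v.
Proof.
move=> /(_ (combinations (fun k : 'I_(size s) => s`_k))); apply => x /= xs.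
have xi : (index x s < size s)%N by rewrite index_mem.
rewrite -(nth_index 0 xs).
exact: (combination_mem (fun k : 'I_(size s) => s`_k) (Ordinal xi)).
Qed.
End FiniteSpan.

(** * Tensor product of a field with a group *)
Section Tensor.
Variables (F : fieldType) (A : groupType).

(** The group need not be abelian: the relations identify [x y] with [y x], so
that the result is the tensor product of [F] with the abelianization of [A].
For [F = rat] it is convertible with [tensorQ A]. *)
Definition tensor_rel : set {freeg A / F} :=
  [set << (x * y)%g >> - << x >> - << y >> | x in setT & y in setT].

Definition tensor : lmodType F := quotm (spanned tensor_rel).

Definition pure (x : A) : tensor := \pi_(quotm (spanned tensor_rel))%qT << x >>.

Lemma pi_tensorP c (u v : {freeg A / F}) :
  (\pi_(quotm (spanned tensor_rel)) (c *: u + v) =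
   c *: (\pi_(quotm (spanned tensor_rel)) u : tensor) +
   \pi_(quotm (spanned tensor_rel)) v)%qT.
Proof. exact: quotm_pi_linear. Qed.

Lemma pureM x y : pure (x * y)%g = pure x + pure y.
Proof.
have -> : pure x + pure y = (\pi_(quotm (spanned tensor_rel)) (<< x >> + << y >>))%qT.
  by rewrite -[<< x >>]scale1r pi_tensorP !scale1r.
by apply/quotm_eq => S; apply; exists x => //; exists y => //; rewrite opprD addrA.
Qed.

Lemma pure_span v : spanned (range pure) v.
Proof.
move=> S Sp; elim/quotW: v => u.
rewrite -(freeg_sumE u).
elim: (dom u) => [|x l IH].
  by rewrite big_nil; apply: (submodule0 S).
rewrite big_cons.
have -> : << coeff x u *g x >> = coeff x u *: << x >> :> {freeg A / F}.
  by apply/eqP/freeg_eqP => y; rewrite coeff_fgscale !coeffU mul1r.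
rewrite pi_tensorP; apply: submoduleP => //.
by apply: Sp; exists x.
Qed.

Lemma tensor_lift (W : lmodType F) (f : A -> W) :
  (forall x y, f (x * y)%g = f x + f y) ->
  exists phi : {linear tensor -> W}, forall x, phi (pure x) = f x.
Proof.
move=> fM.
have relK u v : spanned tensor_rel (u - v) -> fglift f u = fglift f v.
  move=> /(_ (kernel (fglift f))) uv; apply/eqP; rewrite -subr_eq0 -linearB; apply/eqP.
  apply: uv => _ [x _ [y _ <-]] /=.
  by rewrite !linearB /= !liftU !scale1r fM addrAC addrK subrr.
pose phi (v : tensor) : W := fglift f (repr v).
have phiE u : phi (\pi_(quotm (spanned tensor_rel)) u)%qT = fglift f u.
  exact/relK/quotm_repr.
have philin : linear phi.
  move=> c u v; elim/quotW: u => u; elim/quotW: v => v.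
  by rewrite -pi_tensorP !phiE linearP.
exists (HB.pack_for {linear tensor -> W} phi
  (GRing.isLinear.Build _ _ _ _ _ philin)) => x /=.
by rewrite phiE liftU scale1r.
Qed.
End Tensor.

Lemma tensor_ext (F : fieldType) (B : groupType) (W : lmodType F)
    (phi psi : {linear tensor F B -> W}) :
  (forall x, phi (pure F x) = psi (pure F x)) -> forall v, phi v = psi v.
Proof.
move=> eq_pure v.
apply/eqP; rewrite -subr_eq0; apply/eqP.
apply: (pure_span v (S := kernel (phi \- psi))) => _ [x _ <-] /=.
by rewrite eq_pure subrr.
Qed.

Lemma pure_conj (F : fieldType) (B : groupType) (x y : B) : pure F (x ^ y)%g = pure F x.
Proof.
by apply: (addrI (pure F y)); rewrite -pureM mulVKg pureM addrC.
Qed.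

Lemma torsion_tensor (A : groupType) :
  (forall a : A, exists m, (a ^+ m.+1 = 1)%g) -> forall v : tensor rat A, v = 0.
Proof.
move=> tors v.
have p1 : pure rat (1%g : A) = 0.
  have := pureM rat (1%g : A) 1%g.
  by rewrite mulg1 => /eqP; rewrite addrC -subr_eq subrr eq_sym => /eqP.
have pX (a : A) m : pure rat (a ^+ m)%g = m%:R *: pure rat a.
  elim: m => [|m IH].
    by rewrite expg0 p1 scale0r.
  by rewrite expgS pureM IH -natr1 scalerDl scale1r addrC.
apply: (pure_span v (S := zero_submodule _)) => _ [a _ <-] /=.
have [m am] := tors a; have := pX a m.+1; rewrite am p1 => /esym/eqP.
by rewrite scaler_eq0 pnatr_eq0 => /eqP.
Qed.

(** * Finitely generated groups *)
Section GeneratedGroups.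
Local Open Scope group_scope.
Variables (G : groupType) (l : seq G).
Hypothesis l_gen : gen [set` l] = setT :> set G.

Lemma gen_ind (H : subgroup G) : (forall x, x \in l -> H x) -> forall x, H x.
Proof.
move=> lH x; have : gen [set` l] x by rewrite l_gen.
by apply.
Qed.

(** Trees code iterated divisions; every element of the group is the value of
one, since these values form a subgroup. *)
Fixpoint tree_value (t : GenTree.tree nat) : G :=
  match t with
  | GenTree.Leaf i => nth 1 l i
  | GenTree.Node _ [:: t1; t2] => tree_value t1 / tree_value t2
  | _ => 1
  end.

Lemma gen_enum : exists e : nat -> G, forall x, exists n, e n = x.
Proof.
pose e n := if choice.unpickle n is Some t then tree_value t else 1.
exists e.
have V1 : exists t, tree_value t = 1 by exists (GenTree.Node 0%N [::]).
have VF x y : (exists t, tree_value t = x) -> (exists t, tree_value t = y) ->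
    exists t, tree_value t = x / y.
  by move=> [t <-] [u <-]; exists (GenTree.Node 0%N [:: t; u]).
have tree x : exists t, tree_value t = x.
  apply: (gen_ind (H := Subgroup V1 VF)) => {}x xl.
  by exists (GenTree.Leaf (index x l)); rewrite /= nth_index.
by move=> x; have [t <-] := tree x; exists (choice.pickle t); rewrite /e choice.pickleK.
Qed.

Lemma commg_divl (x y z : G) : [~ x / y, z] = ([~ x, z] / [~ y, z]) ^ y^-1.
Proof.
rewrite /commg /conjg !(invgM, invgK) !mulgA.
by rewrite ?(mulgK, mulgVK, mulgV, mulVg, mul1g, mulg1).
Qed.

(** Modulo [N] the generators commute, so the quotient by [N] is abelian. *)
Lemma derived_sub_normal (N : nsubgroup G) :
  (forall a b, a \in l -> b \in l -> N [~ a, b]) -> forall x, derived G x -> N x.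
Proof.
move=> Nl.
have N1 z : N [~ 1, z] by rewrite comm1g; exact: subgroup1.
have NF z x y : N [~ x, z] -> N [~ y, z] -> N [~ x / y, z].
  by move=> Nx Ny; rewrite commg_divl; apply: nsubgroupJ; exact: subgroupF.
have Nlr x b : b \in l -> N [~ x, b].
  by move=> bl; apply: (gen_ind (H := Subgroup (N1 b) (NF b))) => a al; exact: Nl.
have Nsym x y : N [~ x, y] -> N [~ y, x].
  by move=> Nxy; rewrite -invgR; exact: subgroupV.
move=> x; apply=> _ [a _ [b _ <-]].
apply: (gen_ind (H := Subgroup (N1 b) (NF b))) => c cl.
by apply: Nsym; exact: Nlr.
Qed.
End GeneratedGroups.

(** * Conjugation on the abelianized derived subgroup *)
Section ConjugationAction.
Variables (F : fieldType) (G : groupType).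
Notation A := (subg (derived G)).
Notation M := (tensor F A).

Lemma sub_derivedP (x : A) g : `[< derived G (val x ^ g)%g >].
Proof. by apply/asboolP/nsubgroupJ/asboolP/(valP x). Qed.

Definition conjA (g : G) (x : A) : A := Sub (val x ^ g)%g (sub_derivedP x g).

Lemma conjAM g x y : conjA g (x * y)%g = (conjA g x * conjA g y)%g.
Proof. by apply: val_inj; exact: conjMg. Qed.

Lemma conj_action_exists g : exists phi : {linear M -> M},
  forall x, phi (pure F x) = pure F (conjA g x).
Proof. by apply: tensor_lift => x y; rewrite conjAM pureM. Qed.

Definition act g : {linear M -> M} := sval (cid (conj_action_exists g)).

Lemma act_pure g x : act g (pure F x) = pure F (conjA g x).
Proof. by rewrite /act; case: cid. Qed.

Lemma act_mul g h v : act (g * h)%g v = act h (act g v).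
Proof.
apply: (tensor_ext (psi := act h \o act g)) => x /=.
by rewrite !act_pure; congr pure; apply: val_inj; rewrite /= conjgM.
Qed.

Lemma act1 v : act 1%g v = v.
Proof.
apply: (tensor_ext (psi := idfun)) => x /=.
by rewrite act_pure; congr pure; apply: val_inj; rewrite /= conjg1.
Qed.

(** The two composites differ by the conjugation by the commutator of [h] and
[g], which lies in the derived subgroup and so acts trivially. *)
Lemma act_comm g h v : act g (act h v) = act h (act g v).
Proof.
apply: (tensor_ext (phi := act g \o act h) (psi := act h \o act g)) => x /=.
rewrite !act_pure.
have cA : derived G [~ h, g]%g.
  by apply: sub_gen; exists h => //; exists g.
pose c : A := Sub [~ h, g]%g (asboolT cA).
rewrite -(pure_conj F (conjA h (conjA g x)) c); congr pure; apply: val_inj => /=.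
change ((val x ^ h) ^ g = ((val x ^ g) ^ h) ^ [~ h, g])%g.
by rewrite -!conjgM mulgA -commgC.
Qed.

End ConjugationAction.

(** * Equivariant homomorphisms and the characteristic variety *)
Section CharacteristicVariety.
Variables (F : fieldType) (G : groupType) (rho : {multiplicative G -> nonzero F}).
Variable f : G -> F.
Hypothesis fM : forall x y, derived G x -> derived G y -> f (x * y)%g = f x + f y.
Hypothesis fJ : forall x g, derived G x -> f (x ^ g)%g = val (rho g) * f x.

(** A twisted cocycle [psi] on [G], that is a function with
[psi (g h) = psi g + rho(g)^-1 psi h], extends linearly to the bar chains and
kills the boundaries. When [rho g0 != 1], the function [f] is the restriction
to [G'] of such a cocycle, the one normalized by [psi g0 = 0]; solving the
cocycle equation for [psi (g0 x g0^-1 x^-1)] gives its formula. The chain [x0]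
is a cycle because [rho] is trivial on [G'], and [psi x0 = f x0] is not zero,
so it is not a boundary. *)
Lemma equivariant_homology g0 x0 : val (rho g0) != 1 ->
  derived G x0 -> f x0 != 0 -> dim_ge (first_homology rho) 1.
Proof.
move=> rho_g0 Dx0 fx0.
pose k := (val (rho g0))^-1 - 1.
have k0 : k != 0 by rewrite subr_eq0 -invr1 (inj_eq invr_inj).
have Dc x y : derived G [~ x, y]%g by apply: sub_gen; exists x => //; exists y.
have rhoV g : val (rho g^-1%g) = (val (rho g))^-1 by rewrite mul_morphV.
pose psi (x : G) : F^o := f [~ g0^-1, x^-1]%g / k.
have psiM g h : psi (g * h)%g = psi g + (val (rho g))^-1 * psi h.
  rewrite /psi.
  have -> : [~ g0^-1, (g * h)^-1]%g =
      ([~ g0^-1, g^-1] * [~ g0^-1, h^-1] ^ g^-1)%g.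
    by rewrite /commg /conjg !(mulgA, invgM, invgK) ?(mulgK, mulgVK).
  rewrite fM //; last exact: nsubgroupJ.
  by rewrite fJ // rhoV mulrDl mulrA.
have psi_x0 : psi x0 = f x0.
  rewrite /psi.
  have -> : [~ g0^-1, x0^-1]%g = (x0 ^ g0^-1 * x0^-1)%g.
    by rewrite /commg /conjg !(mulgA, invgM, invgK).
  have fV : f x0^-1%g = - f x0.
    apply/eqP; rewrite -addr_eq0 -fM ?mulVg //; last exact: subgroupV.
    have := fM (subgroup1 (derived G)) (subgroup1 (derived G)).
    by rewrite mulg1 => /eqP; rewrite addrC -subr_eq subrr eq_sym.
  rewrite fM ?fJ //; [|exact: nsubgroupJ|exact: subgroupV].
  rewrite fV rhoV (_ : _ * _ + _ = f x0 * k) ?mulfK // /k.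
  by rewrite mulrBr mulr1 mulrC.
have boundary_psi z : fglift psi (bar2 rho z) = 0.
  rewrite -(freeg_sumE z) !linear_sum big1 // => -[g h] _.
  rewrite /= !liftU !linearZ /= linearD linearB linearZ /= !liftU !scale1r /=.
  rewrite psiM /GRing.scale /=; ring.
have rho_x0 : val (rho x0) = 1.
  have K1 : val (rho 1%g) = 1 by rewrite mul_morph1.
  have KF x y : val (rho x) = 1 -> val (rho y) = 1 -> val (rho (x / y)%g) = 1.
    by move=> rx ry; rewrite gmulfM mul_morphV /= rx ry mul1r invr1.
  apply: (Dx0 (Subgroup K1 KF)) => _ [a _ [b _ <-]] /=.
  rewrite /commg /conjg !(gmulfM, mul_morphV) /=.
  by field; rewrite !(valP (rho _)).
have cyc : `[< cycles rho << x0 >> >].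
  by apply/asboolP; rewrite /= /cycles_set /bar1 /= liftU rho_x0 invr1 subrr scaler0.
pose z0 : subm (cycles rho) := Sub << x0 >> cyc.
exists (fun=> \pi_(quotm (restrict_submodule (cycles rho) (boundaries rho)))%qT z0).
move=> c; rewrite big_ord1 => c0 i; rewrite ord1.
apply: contrapT => /eqP ci.
have : (\pi_(quotm (restrict_submodule (cycles rho) (boundaries rho))) z0 =
   \pi_(quotm (restrict_submodule (cycles rho) (boundaries rho))) 0)%qT.
  by apply: (scalerI ci); rewrite c0; apply/esym/scaler0.
move=> /quotm_eq[z]; rewrite subr0 => zx0.
have := boundary_psi z; rewrite zx0 /= liftU scale1r psi_x0.
by apply/eqP.
Qed.
End CharacteristicVariety.

(** * Finite dimension of the complex module *)
Lemma eigen_ratio (F : fieldType) (V : lmodType F) (v w u : V) (c d : F) :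
  d != 0 -> w - (c / d) *: v = d^-1 *: ((u - c *: v) - (u - d *: w)).
Proof.
move=> d0; rewrite opprB [X in d^-1 *: X]addrC addrA subrK.
by rewrite scalerBr !scalerA mulVf // scale1r mulrC.
Qed.

Section FiniteDimension.
Variables (R : realType) (G : groupType) (l : seq G).
Hypothesis l_gen : gen [set` l] = setT :> set G.
Hypothesis V1_finite : finite_set (V1 R G).
Notation C := R[i].
Notation A := (subg (derived G)).
Notation M := (tensor C A).
Notation T := (act C (G := G)).
Notation zero := (zero_submodule M).

Lemma zero_stable : stable T zero.
Proof. by move=> g v /= ->; rewrite linear0. Qed.

(** The class of an element of [G'], extended by a default value to all of [G]
so that membership proofs do not appear in terms. *)
Definition pureG (x : G) : M := pure C (insubd (1%g : A) x).

Lemma pureGE (x : A) : pureG (val x) = pure C x.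
Proof. by rewrite /pureG valKd. Qed.

Lemma pureGM x y : derived G x -> derived G y ->
  pureG (x * y)%g = pureG x + pureG y.
Proof.
move=> Dx Dy.
pose x' : A := Sub x (asboolT Dx); pose y' : A := Sub y (asboolT Dy).
by rewrite (pureGE (x' * y')%g) (pureGE x') (pureGE y') pureM.
Qed.

Lemma pureGJ x g : derived G x -> pureG (x ^ g)%g = T g (pureG x).
Proof.
move=> Dx; pose x' : A := Sub x (asboolT Dx).
by rewrite (pureGE x') act_pure -pureGE.
Qed.

Lemma pureG_span v : spanned [set pureG x | x in derived G] v.
Proof.
move=> S SA; apply: (pure_span v (S := S)) => _ [x _ <-].
by rewrite -pureGE; apply: SA; exists (val x) => //; apply/asboolP/(valP x).
Qed.

Definition commutator_gens : seq M := [seq pureG [~ a, b]%g | a <- l, b <- l].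

(** The elements of [G'] whose class lies in a stable submodule form a normal
subgroup of [G]. *)
Lemma commutator_generating : generating T zero commutator_gens.
Proof.
move=> S Sst S0 Sgens v; apply: pureG_span => _ [x Dx <-].
have p1 : pureG 1%g = 0.
  have := pureGM (subgroup1 (derived G)) (subgroup1 (derived G)).
  by rewrite mulg1 => /eqP; rewrite addrC -subr_eq subrr eq_sym => /eqP.
pose N x := derived G x /\ S (pureG x).
have N1 : N 1%g by split; [exact: subgroup1 | rewrite p1; exact: submodule0].
have pV y : derived G y -> pureG y^-1%g = - pureG y.
  move=> Dy; apply/eqP; rewrite -addr_eq0 -pureGM ?mulVg ?p1 //.
  exact: subgroupV.
have NF y z : N y -> N z -> N (y / z)%g.
  move=> [Dy Sy] [Dz Sz]; split; first exact: subgroupF.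
  rewrite pureGM ?pV //; last exact: subgroupV.
  by apply: submoduleD => //; exact: submoduleN.
have NJ y z : Subgroup N1 NF y -> Subgroup N1 NF (y ^ z)%g.
  move=> [Dy Sy]; split; first exact: nsubgroupJ.
  by rewrite pureGJ //; exact: Sst.
suff [] : NSubgroup NJ x by [].
apply: (derived_sub_normal l_gen) Dx => a b al bl; split.
  by apply: sub_gen; exists a => //; exists b.
by apply: Sgens; apply/allpairsP; exists (a, b).
Qed.

(** The group is finitely generated, hence countable. *)
Lemma countable_span : exists e : nat -> M,
  forall v, exists N, combination (fun k : 'I_N => e k) v.
Proof.
have [e eP] := gen_enum l_gen.
exists (fun n => pureG (e n)).
have widen N N' v : (N <= N')%N ->
    combination (fun k : 'I_N => pureG (e k)) v ->
    combination (fun k : 'I_N' => pureG (e k)) v.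
  move=> NN' [c ->]; apply: (@submodule_sum _ _ (combinations _)) => k _.
  apply: submoduleZ.
  exact: (combination_mem (fun k : 'I_N' => pureG (e k)) (widen_ord NN' k)).
have K0 : exists N, combination (fun k : 'I_N => pureG (e k)) 0.
  by exists 0%N; exact: combination0.
have KP c u v : (exists N, combination (fun k : 'I_N => pureG (e k)) u) ->
    (exists N, combination (fun k : 'I_N => pureG (e k)) v) ->
    exists N, combination (fun k : 'I_N => pureG (e k)) (c *: u + v).
  move=> [N uN] [N' vN']; exists (maxn N N'); apply: combinationP.
    by apply: widen uN; exact: leq_maxl.
  by apply: widen vN'; exact: leq_maxr.
move=> v; apply: (pureG_span v (S := Submodule K0 KP)) => _ [x _ <-] /=.
have [n <-] := eP x; exists n.+1.
exact: (combination_mem (fun k : 'I_n.+1 => pureG (e k)) ord_max).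
Qed.

(** A common eigenvalue of all [T h] on a quotient, composed with a functional,
is an equivariant homomorphism on [G'], and [rho h] is the eigenvalue of [T h].
The value [a = 1] is set apart because [equivariant_homology] says nothing
about the trivial character. *)
Lemma eigenvalue_in_V1 g a y :
  ~ image_mod T zero (shift (Gen C g) a) y ->
  a = 1 \/ exists2 rho, V1 R G rho & a = val (rho g).
Proof.
move=> nim.
have [e e_span] := countable_span.
set S1 := image_mod _ _ _ in nim.
have S1st : stable T S1 by apply: image_stable; [exact: act_comm|exact: zero_stable].
have S1gen : generating T S1 commutator_gens.
  apply: generating_sub commutator_generating => v; exact: sub_image.
have [S [z [Sst S1S Sz eig_l]]] := exists_common_eigenvalues (@act_comm C G)
  (@complex_uncountable R) e_span l S1st S1gen nim.
have eigg v : S (T g v - a *: v).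
  by apply: S1S; rewrite -(op_shift T (Gen C g)); exact: image_op.
have eig h : exists c, forall v, S (T h v - c *: v).
  have H1 : exists c, forall v, S (T 1%g v - c *: v).
    by exists 1 => v; rewrite act1 scale1r subrr; exact: submodule0.
  have HF x h' : (exists c, forall v, S (T x v - c *: v)) ->
      (exists c, forall v, S (T h' v - c *: v)) ->
      exists c, forall v, S (T (x / h')%g v - c *: v).
    move=> [c cP] [d dP].
    have d0 : d != 0.
      apply/eqP => d0; apply: Sz.
      rewrite -[z](@act1 C G) -(mulVg h') act_mul.
      by have := dP (T h'^-1%g z); rewrite d0 scale0r subr0.
    exists (c / d) => v; rewrite act_mul.
    set w := T h'^-1%g (T x v).
    have := dP w; rewrite {1}/w -act_mul mulVg act1 => Sw.
    rewrite (eigen_ratio v w (T x v) c d0).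
    apply: submoduleZ; apply: submoduleD => //; exact: submoduleN.
  exact: (gen_ind l_gen (H := Subgroup H1 HF)).
have [phi phiS phiz] := exists_functional Sz.
have phiT h v : phi (T h v) = phi (T h z) * phi v.
  have [c cP] := eig h.
  have E w : phi (T h w) = c * phi w.
    apply/eqP; rewrite -subr_eq0; apply/eqP.
    by have := phiS _ (cP w); rewrite linearB linearZ.
  by rewrite !E phiz mulr1.
have phi0 h : phi (T h z) != 0.
  apply/eqP => h0; have := phiT h (T h^-1%g z).
  by rewrite -act_mul mulVg act1 phiz h0 mul0r => /eqP; rewrite oner_eq0.
pose r (h : G) : nonzero C := Sub (phi (T h z)) (phi0 h).
have rM : {morph r : x y / (x * y)%g}.
  move=> x h; apply: val_inj => /=.
  by rewrite act_mul phiT mulrC.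
pose rho := HB.pack_for {multiplicative G -> nonzero C} r
  (isMultiplicative.Build _ _ r rM).
have rhog : a = val (rho g).
  have : phi (T g z - a *: z) = 0 by exact: phiS.
  rewrite linearB linearZ /= phiz => /eqP; rewrite subr_eq0 => /eqP ->.
  by rewrite /GRing.scale /= mulr1.
have [[g0 rg0]|triv] := pselect (exists g0, val (rho g0) != 1); last first.
  left; rewrite rhog; apply: contrapT => /eqP ?; apply: triv; by exists g.
right; exists rho => //.
have [x0 [Dx0 fx0]] : exists x0, derived G x0 /\ phi (pureG x0) != 0.
  apply: contrapT => none.
  have : phi z = 0.
    apply: (pureG_span z (S := kernel phi)).
    move=> _ [x Dx <-]; apply: contrapT => /eqP ?; apply: none; by exists x.
  by rewrite phiz => /eqP; rewrite oner_eq0.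
apply: (equivariant_homology (f := fun x => phi (pureG x)) _ _ rg0 Dx0 fx0).
  by move=> x h Dx Dh; rewrite pureGM // linearD.
by move=> x h Dx; rewrite pureGJ // phiT.
Qed.

(** All but finitely many [a] make [T g - a] onto, so every vector is killed by
a polynomial in [T g]; the product over the generators kills the module. *)
Lemma act_annihilated g : exists2 q : {poly C}, q != 0 &
  forall v, op T (polyop (Gen C g) q) v = 0.
Proof.
have [e e_span] := countable_span.
pose onto a := forall v, image_mod T zero (shift (Gen C g) a) v.
have unc : ~ countable [set a | onto a].
  move=> cnt; apply: (@complex_uncountable R).
  pose B : set C := [set 1] `|` [set val (rho g) | rho in V1 R G].
  apply: (@sub_countable _ _ _ ([set a | onto a] `|` B)).
    apply: subset_card_le => a _.
    have [oa|noa] := pselect (onto a); [by left | right].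
    have [y nim] : exists y, ~ image_mod T zero (shift (Gen C g) a) y.
      by apply: contrapT => none; apply: noa => y; apply: contrapT => ?;
         apply: none; exists y.
    by have [->|[rho Vrho ->]] := eigenvalue_in_V1 nim; [left|right; exists rho].
  rewrite -bigcup2E; apply: bigcup_countable => // -[|[|i]] _ //=.
  apply: finite_set_countable.
  by rewrite /B finite_setU; split; [exact: finite_set1 | exact: finite_image].
have ann v : exists2 q : {poly C}, q != 0 & op T (polyop (Gen C g) q) v = 0.
  exact: (annihilating_poly (@act_comm C G) e_span unc zero_stable
    commutator_generating (fun a H => H)).
have [q q0 qs] : exists2 q : {poly C}, q != 0 &
    forall v, v \in commutator_gens -> op T (polyop (Gen C g) q) v = 0.
  elim: commutator_gens => [|v s [q q0 qs]]; first by exists 1; rewrite ?oner_neq0.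
  have [p p0 pv] := ann v; exists (p * q); first by rewrite mulf_neq0.
  move=> w; rewrite inE => /predU1P[->|ws].
    by rewrite mulrC polyopM pv linear0.
  by rewrite polyopM qs // linear0.
exists q => // v.
apply: (commutator_generating (S' := kernel (op T (polyop (Gen C g) q)))) => //.
- by move=> h w /= w0; rewrite (op_gen (@act_comm C G)) w0 linear0.
- by move=> w /= ->; rewrite linear0.
Qed.

(** Inverses of the generators are added to the list so that the finite span is
stable under the whole group. *)
Lemma tensor_finite : exists d, forall w : 'I_d.+1 -> M, dependent w.
Proof.
pose l' := l ++ [seq x^-1%g | x <- l].
have [|s [gs st]] := finite_stable_span (@act_comm C G) (l := l') commutator_gens.
  by move=> g _; exact: act_annihilated.
exists (size s) => w; apply: more_vectors_dependent => k.
apply: spanned_combination.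
pose W := spanned [set` s].
apply: (commutator_generating (S' := W)) => //; last first.
  by move=> v /= ->; exact: (submodule0 W).
pose P g := forall v, W v -> W (T g v) /\ W (T g^-1%g v).
have P1 : P 1%g by move=> v Wv; rewrite invg1 act1.
have PF x y : P x -> P y -> P (x / y)%g.
  move=> Px Py v Wv; rewrite invgF !act_mul.
  by split; [apply: (Py _ (Px _ Wv).1).2 | apply: (Px _ (Py _ Wv).1).2].
have Pl x : x \in l -> P x.
  move=> xl v Wv; split; apply: st => //; rewrite mem_cat ?xl //.
  by rewrite map_f ?orbT.
by move=> g v Wv; have [] := gen_ind l_gen (H := Subgroup P1 PF) Pl g v Wv.
Qed.
End FiniteDimension.

(** * Homomorphisms to the rational numbers *)

(** Divisibility of the rationals: the homomorphism [m x |-> m] that vanishes on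
[N] extends to [V]. By Zorn take a subgroup [W] that contains [N] and is
maximal among those containing no positive multiple of [x]. Then each [a] has a
nonzero multiple [k a] congruent modulo [W] to a multiple [m x], and [f a] is
[m / k]. *)
Lemma rational_hom_zmod (V : zmodType) (N : set V) (x : V) :
  N 0 -> (forall u v, N u -> N v -> N (u - v)) ->
  (forall m, ~ N (x *+ m.+1)) ->
  exists f : V -> rat, [/\ forall a b, f (a + b) = f a + f b,
    forall a, N a -> f a = 0 & f x = 1].
Proof.
move=> N0 NB Nx.
pose good (W : set V) := [/\ forall v, N v -> W v,
  forall u v, W u -> W v -> W (u - v) & forall m, ~ W (x *+ m.+1)].
have [|W [gW maxW]] := @Zorn_bigcup V (fun W => W = set0 \/ good W).
  move=> C CP Ctot.
  have [[W0 [CW0 gW0]]|noW] := pselect (exists W0, C W0 /\ good W0); last first.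
    left; apply/seteqP; split => // v [W CW Wv].
    have [W0|gW] := CP _ CW; first by rewrite W0 in Wv.
    by case: noW; exists W.
  right; split.
  - by move=> v Nv; exists W0 => //; case: gW0 => + _ _; exact.
  - move=> u v [W1 CW1 W1u] [W2 CW2 W2v].
    have cl W' : C W' -> W' u -> W' v -> W' (u - v).
      move=> CW' uW' vW'; have [W'0|[_ + _]] := CP _ CW'; last exact.
      by rewrite W'0 in uW'.
    by case: (Ctot _ _ CW1 CW2) => sub; [exists W2 | exists W1] => //;
       apply: cl => //; exact: sub.
  - move=> m [W1 CW1 W1x]; have [W10|[_ _ /(_ m)]] := CP _ CW1; last exact.
    by rewrite W10 in W1x.
have {gW}[NW WB Wx] : good W.
  case: gW => // W0; exfalso; apply: (maxW N); last by right.
  by rewrite W0; split => // /(_ 0 N0).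
have W0 : W 0 by exact: NW.
have WN u : W u -> W (- u) by move=> Wu; rewrite -sub0r; exact: WB.
have WD u v : W u -> W v -> W (u + v).
  by move=> Wu Wv; rewrite -[v]opprK; apply: WB => //; exact: WN.
have WMn u n : W u -> W (u *+ n).
  by move=> Wu; elim: n => [|n IH]; rewrite ?mulr0n // mulrS; exact: WD.
have WMz u (z : int) : W u -> W (u *~ z).
  move=> Wu; case: z => n; first exact: WMn.
  by apply: WN; exact: WMn.
have Wxz (z : int) : W (x *~ z) -> z = 0.
  case: z => [[|n]|n] // Wz; first by case: (Wx n).
  by case: (Wx n); rewrite -[_ *+ _]opprK; exact: WN.
have coord a : exists km : int * int, km.1 != 0 /\ W (a *~ km.1 - x *~ km.2).
  have [Wa|Wa] := pselect (W a); first by exists (1, 0); rewrite mulr0z subr0.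
  pose B : set V := [set a *~ j + u | j in setT & u in W].
  have nB : ~ good B.
    move=> gB; apply: (maxW B); last by right.
    split=> [u Wu|BW]; first by exists 0 => //; exists u => //; rewrite mulr0z add0r.
    by apply: Wa; apply: BW; exists 1 => //; exists 0 => //; rewrite addr0.
  have [m [j _ [u Wu ju]]] : exists m, B (x *+ m.+1).
    apply: contrapT => nBx; apply: nB; split.
    - by move=> u Nu; exists 0 => //; exists u; [exact: NW | rewrite mulr0z add0r].
    - move=> _ _ [j _ [u Wu <-]] [k _ [v Wv <-]].
      exists (j - k) => //; exists (u - v); first exact: WB.
      by rewrite mulrzBr opprD addrACA.
    - by move=> m Bm; apply: nBx; exists m.
  exists (j, m.+1%:Z); split => /=.
    by apply/eqP => j0; apply: (Wx m); rewrite -ju j0 mulr0z add0r.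
  by rewrite -pmulrn -ju opprD addrA subrr add0r; exact: WN.
pose f a : rat := let km := sval (cid (coord a)) in km.2%:~R / km.1%:~R.
have fE a k m : k != 0 -> W (a *~ k - x *~ m) -> f a = m%:~R / k%:~R.
  rewrite /f; case: cid => -[k' m'] /= [k'0 Wa'] k0 Wa.
  apply/eqP; rewrite eqr_div ?intr_eq0 // -!intrM eqr_int -subr_eq0; apply/eqP.
  apply: Wxz.
  have -> : x *~ (m' * k - m * k') =
      (a *~ k - x *~ m) *~ k' - (a *~ k' - x *~ m') *~ k.
    rewrite !mulrzBl -!mulrzA mulrzBr [k' * k]mulrC opprB.
    by rewrite [in RHS]addrC addrACA addrA addrK.
  by apply: WB; exact: WMz.
have fP a : exists k m, k != 0 /\ W (a *~ k - x *~ m).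
  by have [[k m] ?] := coord a; exists k, m.
exists f; split.
- move=> a b; have [k [m [k0 Wa]]] := fP a; have [k' [m' [k'0 Wb]]] := fP b.
  rewrite (fE _ _ _ k0 Wa) (fE _ _ _ k'0 Wb) addf_div ?intr_eq0 //.
  rewrite -!intrM -intrD; apply: fE; first by rewrite mulf_neq0.
  have -> : (a + b) *~ (k * k') - x *~ (m * k' + m' * k) =
      (a *~ k - x *~ m) *~ k' + (b *~ k' - x *~ m') *~ k.
    rewrite !mulrzBl -!mulrzA mulrzDl mulrzDr [k' * k]mulrC opprD.
    by rewrite addrACA.
  by apply: WD; exact: WMz.
- move=> a Na; rewrite (fE a 1 0) ?mul0r // mulr0z subr0.
  exact: NW.
- by rewrite (fE x 1 1) ?divr1 // subrr.
Qed.

Section AbelianHom.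
Local Open Scope group_scope.

Lemma rational_hom (A : groupType) (N : subgroup A) (x : A) :
  abelian_group A -> (forall m, ~ N (x ^+ m.+1)) ->
  exists f : A -> rat, [/\ forall a b, f (a * b) = (f a + f b)%R,
    forall a, N a -> f a = 0%R & f x = 1%R].
Proof.
move=> Ac Nx.
pose Z : zmodType := HB.pack (A : Type) (Choice.class A)
  (GRing.isZmodule.Build A (@mulgA A) Ac (@mul1g A) (@mulVg A)).
have powE m : (x : Z) *+ m = x ^+ m :> A.
  by elim: m => // m IH; rewrite mulrS expgS -IH.
have [||m|f fP] := @rational_hom_zmod Z (fun a => N a) x.
- exact: subgroup1.
- by move=> u v; exact: subgroupF.
- by rewrite powE.
by exists f.
Qed.
End AbelianHom.

(** * Quotient groups and the lower central series *)
Section Quotients.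
Local Open Scope group_scope.
Variables (K : groupType) (N : nsubgroup K).

Definition proj : {multiplicative K -> quotg N} :=
  HB.pack_for {multiplicative K -> quotg N} (\pi_(quotg N) : K -> quotg N)%qT
    (isMultiplicative.Build _ _ _ (@quotg_piM K N)).

Lemma proj_eq x y : (proj x = proj y) <-> N (x / y).
Proof. exact: quotg_eq. Qed.

Lemma proj_onto a : exists x, proj x = a.
Proof. by exists (repr a); exact: reprK. Qed.

Lemma derived_of_proj x : (forall y, N y -> derived K y) ->
  derived (quotg N) (proj x) -> derived K x.
Proof.
move=> ND.
have lift y z : proj y = proj z -> derived K z -> derived K y.
  move=> /proj_eq/ND Dyz Dz; rewrite -[y](mulgVK z).
  exact: subgroupM.
pose P a := forall z, proj z = a -> derived K z.
have P1 : P 1 by move=> z z1; apply: (lift z 1); rewrite ?mul_morph1 //; exact: subgroup1.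
have PF a b : P a -> P b -> P (a / b).
  have [u <-] := proj_onto a; have [v <-] := proj_onto b.
  move=> Pu Pv z; rewrite -mul_morphV -gmulfM => /lift; apply.
  by apply: subgroupF; [exact: Pu | exact: Pv].
move=> /(_ (Subgroup P1 PF)) Px; apply: Px erefl => _ [a _ [b _ <-]].
have [u <-] := proj_onto a; have [v <-] := proj_onto b.
move=> z zE; apply: (lift z [~ u, v]).
  by rewrite zE /commg /conjg !(gmulfM, mul_morphV).
by apply: sub_gen; exists u => //; exists v.
Qed.
End Quotients.

Lemma derived2_sub (K : groupType) x : derived2 K x -> derived K x.
Proof. exact: comm_nsubgroup_subr. Qed.

Lemma metabelian_quotient (K : groupType) :
  abelian_group (subg (derived (quotg (derived2 K)))).
Proof.
have Dlift (c : subg (derived (quotg (derived2 K)))) :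
    exists2 z, derived K z & proj (derived2 K) z = val c.
  have [z zc] := proj_onto (val c); exists z => //.
  by apply: (derived_of_proj (@derived2_sub K)); rewrite zc; apply/asboolP/(valP c).
move=> a b; apply: val_inj.
have [x Dx xa] := Dlift a; have [y Dy yb] := Dlift b.
change (val a * val b = val b * val a)%g.
rewrite -xa -yb -!gmulfM; apply/proj_eq.
rewrite (commgCV x y) mulgK; apply: sub_gen.
by exists x^-1%g; [exact: subgroupV | exists y^-1%g => //; exact: subgroupV].
Qed.

Lemma lower_central_sub (H : groupType) m n x : (0 < m <= n)%N ->
  lower_central H n x -> lower_central H m x.
Proof.
case/andP=> m0; elim: n => [|n IH]; first by rewrite leqNgt m0.
rewrite leq_eqVlt => /predU1P[->//|]; rewrite ltnS => mn.
case: n mn IH => [|n] mn IH; first by rewrite leqNgt m0 in mn.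
by move=> /comm_nsubgroup_subr; exact: IH.
Qed.

(** * The Alexander invariant and the Chen ranks of the kernel *)
Section AbExact.
Variables (K G Q : groupType).
Variables (i : {multiplicative K -> G}) (p : {multiplicative G -> Q}).
Hypothesis exact_ip : ab_exact i p.
Hypothesis Q_abelian : abelian_group Q.

Lemma derived_abelian x : derived Q x -> x = 1%g.
Proof.
have H1 : (1 = 1 :> Q)%g by [].
have HF (y z : Q) : y = 1%g -> z = 1%g -> (y / z)%g = 1%g.
  by move=> -> ->; rewrite divgg.
move=> /(_ (@Subgroup Q (fun x => x = 1%g) H1 HF)); apply => _ [a _ [b _ <-]] /=.
exact/eqP/commgP/Q_abelian.
Qed.

(** An element of [G'] dies in [Q], so it comes from some [y] in [K]; as it also
dies in the abelianization of [G], and [K_ab] embeds there, [y] lies in [K']. *)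
Lemma derived_lift x : derived G x -> exists2 y, derived K y & i y = x.
Proof.
case: exact_ip => -[_ i_im _] [ab_inj _ _] Dx.
have : [set b | p b = 1%g] x by apply: derived_abelian; exact: derived_morph.
rewrite -i_im => -[y _ iy]; exists y => //.
have : proj (derived K) y = 1%g.
  apply: ab_inj; rewrite mul_morph1 -[LHS]/(ab_fun i _) ab_funE iy.
  by rewrite -[RHS](mul_morph1 (proj _)); apply/proj_eq; rewrite divg1.
by rewrite -(mul_morph1 (proj (derived K))) => /proj_eq; rewrite divg1.
Qed.

Variable R : realType.
Hypothesis G_fg : finitely_generated G.
Hypothesis V1_finite : finite_set (V1 R G).

(** The relation [c] is a linear relation between the classes of the [i (x k)] in
the complex module of [G']; every additive [f] extends to a functional on that
module. A single [c] serves for all [f], which makes the passage from complex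
to rational coefficients possible. *)
Lemma bounded_rank : exists d, forall x : 'I_d.+1 -> K,
  (forall k, derived K (x k)) ->
  exists2 c : 'I_d.+1 -> R[i], (exists k, c k != 0) &
    forall f : K -> R[i], (forall y z, derived K y -> derived K z ->
      f (y * z)%g = f y + f z) -> \sum_k c k * f (x k) = 0.
Proof.
have [l l_gen] := G_fg; have [d dep] := tensor_finite l_gen V1_finite.
exists d => x Dx; have [c ck c0] := dep (fun k => pureG R (i (x k))).
exists c => // f fM.
have inv_ex (a : subg (derived G)) : exists y, derived K y /\ i y = val a.
  have /asboolP/derived_lift[y Dy iy] := valP a; by exists y.
pose inv a := sval (cid (inv_ex a)).
have invD a : derived K (inv a) by rewrite /inv; case: cid => ? [].
have invE a : i (inv a) = val a by rewrite /inv; case: cid => ? [].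
have i_inj : injective i by case: exact_ip => -[].
have invM a b : inv (a * b)%g = (inv a * inv b)%g.
  by apply: i_inj; rewrite invE gmulfM !invE.
have [phi phiE] := @tensor_lift R[i] (subg (derived G)) R[i]^o (f \o inv)
  (fun a b => etrans (congr1 f (invM a b)) (fM _ _ (invD a) (invD b))).
have phix k : phi (pureG R (i (x k))) = f (x k).
  have Dix := derived_morph i (Dx k).
  pose a : subg (derived G) := Sub (i (x k)) (asboolT Dix).
  rewrite (pureGE R a) phiE /=; congr f; apply: i_inj; exact: invE.
have := congr1 phi c0; rewrite linear0 linear_sum => {2}<-.
by apply: eq_bigr => k _; rewrite linearZ /= phix.
Qed.

(** Functionals dual to [d + 1] independent pure tensors would give additive maps
that take the relation of [bounded_rank] to each of its coefficients. *)
Lemma alexander_finite : fin_dim (tensorQ (alexander_invariant K)).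
Proof.
have [d rank] := bounded_rank.
pose B := alexander_invariant K.
pose cls (y : K) : B :=
  proj (restrict_nsubgroup (derived K) (derived2 K)) (insubd 1%g y).
have clsM y z : derived K y -> derived K z -> cls (y * z)%g = (cls y * cls z)%g.
  move=> Dy Dz; rewrite /cls -[RHS]gmulfM; congr (proj _ _); apply: val_inj.
  change (val (insubd (1%g : subg (derived K)) (y * z)%g) =
    val (insubd (1%g : subg (derived K)) y) * val (insubd (1%g : subg (derived K)) z))%g.
  by rewrite !insubdK //; apply/asboolP => //; exact: subgroupM.
apply: (@fin_dim_of_bound _ (tensor rat B) (range (pure rat (A := B))) d).
  exact: pure_span.
move=> e /= eA; apply: contrapT => ndep.
have /fin_all_exists[x xP] : forall k, exists x : K,
    derived K x /\ pure rat (cls x) = e k.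
  move=> k; have [a _ <-] := eA k; have [b <-] := proj_onto a.
  by exists (val b); split; [apply/asboolP/(valP b) | rewrite /cls valKd].
have [c [k ck] c0] := rank x (fun k => (xP k).1).
have [phi phiE] := dual_functional k ndep.
have := c0 (fun y => ratr (phi (pure rat (cls y)))).
rewrite (bigD1 k) //= (xP k).2 phiE eqxx rmorph1 mulr1 big1 => [h|j jk].
  move/eqP: ck; apply; rewrite -[c k]addr0; apply: h => y z Dy Dz.
  by rewrite clsM // pureM linearD rmorphD.
by rewrite (xP j).2 phiE (negPf jk) rmorph0 mulr0.
Qed.

(** Otherwise infinitely many indices are bad. Along an increasing sequence of
bad indices [(nx k).1], with witnesses [(nx k).2], there are homomorphisms that
take the value 1 at the [k]-th witness and vanish at the later ones. Applied to
a relation of [bounded_rank], with [k] the least index of a nonzero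
coefficient, such a homomorphism forces this coefficient to vanish. *)
Lemma lower_central_torsion : exists N, forall n, (N <= n)%N ->
  forall h, lower_central (quotg (derived2 K)) n h ->
  exists m, lower_central (quotg (derived2 K)) n.+1 (h ^+ m.+1)%g.
Proof.
set H := quotg (derived2 K).
apply: contrapT => none.
pose bad n h := lower_central H n h /\ forall m, ~ lower_central H n.+1 (h ^+ m.+1)%g.
have bad_ex N : exists nh : nat * H, (N < nh.1)%N /\ bad nh.1 nh.2.
  apply: contrapT => good; apply: none; exists N.+1 => n Nn h hn.
  apply: contrapT => nt; apply: good; exists (n, h); split => //; split => // m hm.
  by apply: nt; exists m.
have [d rank] := bounded_rank.
(* Starting above 1 puts all witnesses in the derived subgroup of [H]. *)
pose nx := fix nx k : nat * H :=
  sval (cid (bad_ex (if k is k'.+1 then (nx k').1 else 1%N))).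
have nxP k : ((if k is k'.+1 then (nx k').1 else 1%N) < (nx k).1)%N /\
    bad (nx k).1 (nx k).2.
  by case: k => [|k] /=; case: cid.
have nx_mono j k : (j < k)%N -> ((nx j).1 < (nx k).1)%N.
  elim: k => // k IH; rewrite ltnS leq_eqVlt => /predU1P[->|/IH jk].
    exact: (nxP k.+1).1.
  exact: ltn_trans jk (nxP k.+1).1.
have nx2 k : (1 < (nx k).1)%N.
  case: k => [|k]; first exact: (nxP 0%N).1.
  exact: ltn_trans (nxP 0%N).1 (nx_mono 0%N k.+1 isT).
have hD k : derived H (nx k).2.
  exact: (@lower_central_sub H 2 _ _ (nx2 k) (nxP k).2.1).
have /choice[x xE] : forall k, exists x : K, proj (derived2 K) x = (nx k).2.
  by move=> k; exact: proj_onto.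
have Dx k : derived K (x k).
  by apply: (derived_of_proj (@derived2_sub K)); rewrite xE; exact: hD.
have [c [k0 ck0] c0] := rank (fun k => x k) (fun k => Dx k).
have [k ck kmin] : exists2 k : 'I_d.+1, c k != 0 & forall j : 'I_d.+1, (j < k)%N -> c j = 0.
  case: (arg_minnP (P := fun k => c k != 0) (@nat_of_ord d.+1) ck0) => k ck kmin.
  exists k => // j jk; apply/eqP; apply: contraTT jk => /kmin.
  by rewrite -leqNgt.
pose a k : subg (derived H) := Sub (nx k).2 (asboolT (hD k)).
have aX m : val (a k ^+ m)%g = ((nx k).2 ^+ m)%g.
  by elim: m => // m IH; rewrite !expgS -IH.
have [|f [fM fN fa]] := @rational_hom (subg (derived H))
    (restrict_nsubgroup (derived H) (lower_central H (nx k).1.+1)) (a k)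
    (@metabelian_quotient K).
  by move=> m; rewrite /= /restrict_set /= aX; exact: (nxP k).2.2.
pose cls (y : K) : subg (derived H) := insubd 1%g (proj (derived2 K) y).
have clsM y z : derived K y -> derived K z -> cls (y * z)%g = (cls y * cls z)%g.
  move=> Dy Dz; have DH w : derived K w -> derived H (proj (derived2 K) w).
    exact: derived_morph.
  apply: val_inj; change (val (cls (y * z)%g) = val (cls y) * val (cls z))%g.
  rewrite !insubdK ?gmulfM //; apply/asboolP; try exact: DH.
  by rewrite -gmulfM; apply: DH; exact: subgroupM.
have clsx j : cls (x j) = a j by rewrite /cls xE; exact: (valKd _ (a j)).
have := c0 (fun y => ratr (f (cls y))).
rewrite (bigD1 k) //= clsx fa rmorph1 mulr1 big1 => [h|j jk].
  move/eqP: ck; apply; rewrite -[c k]addr0; apply: h => y z Dy Dz.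
  by rewrite clsM // fM rmorphD.
have [jltk|kltj] := ltnP j k; first by rewrite kmin ?mul0r.
rewrite clsx fN ?rmorph0 ?mulr0 //= /restrict_set /=.
apply: (@lower_central_sub H _ (nx j).1); last exact: (nxP j).2.1.
by rewrite /= nx_mono // ltn_neqAle eq_sym jk.
Qed.

Lemma chen_ranks_vanish : exists N, forall n, (N <= n)%N -> has_chen_rank K n 0.
Proof.
have [N tors] := lower_central_torsion; exists N => n Nn.
exists (fun=> 0); split; first by move=> c _ [].
move=> v; exists (fun=> 0); rewrite big_ord0; apply: torsion_tensor => z.
have [h <-] := proj_onto z.
have /asboolP/(tors n Nn)[m hm] := valP h; exists m.
set pr := proj _; have projX j : (pr h ^+ j = pr (h ^+ j))%g.
  by elim: j => [|j IH]; rewrite ?expg0 ?mul_morph1 // !expgS gmulfM IH.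
have valX j : val (h ^+ j)%g = (val h ^+ j)%g.
  by elim: j => // j IH; rewrite !expgS -IH.
rewrite projX -[RHS](mul_morph1 pr); apply/proj_eq.
by rewrite divg1 /= /restrict_set /= valX.
Qed.
End AbExact.

Theorem corollary13p5 (R : realType) (K G Q : groupType)
  (i : {multiplicative K -> G}) (p : {multiplicative G -> Q})
  (K_fg : finitely_generated K) (G_fg : finitely_generated G)
  (Q_fg : finitely_generated Q)
  (KGQ_ab_exact : ab_exact i p)
  (Q_abelian : abelian_group Q)
  (V1_finite : finite_set (V1 R G)) :
  fin_dim (tensorQ (alexander_invariant K)) /\
  (exists N : nat, forall n : nat, (N <= n)%N -> has_chen_rank K n 0).
Proof.
split; first exact: alexander_finite KGQ_ab_exact Q_abelian R G_fg V1_finite.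
exact: chen_ranks_vanish KGQ_ab_exact Q_abelian R G_fg V1_finite.
Qed.
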